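(* $$\sum_{n\geq 0}\frac{1}{(2n+1)^3}\left[\frac{1}{4^n}\binom{2n}{n}\right]^2 ={}_5F_4\left(\tfrac{1}{2},\tfrac{1}{2},\tfrac{1}{2},\tfrac{1}{2},\tfrac{1}{2};1,\tfrac{3}{2},\tfrac{3}{2},\tfrac{3}{2};1\right)= \frac{16}{3\pi}\sum_{n\geq 0}\frac{(-1)^n \mathscr{H}_n^3}{2n+1}-\frac{\log^3(2)}{6}-\frac{\pi^2}{12}\log(2)+\frac{3}{16}\zeta(3)+\frac{4}{3\pi}\beta(4).$$
   Context: $\mathscr{H}_n=\sum_{k=0}^{n}\frac{1}{2k+1}$; the alternating series on the right is understood as the limit of its partial sums (it converges conditionally). $\zeta$ is the Riemann zeta function and $\beta(4)=\sum_{n\geq 0}\frac{(-1)^n}{(2n+1)^4}$. ${}_5F_4(a_1,\dots,a_5;b_1,\dots,b_4;z)=\sum_{n\ge 0}\frac{(a_1)_n\cdots(a_5)_n}{(b_1)_n\cdots(b_4)_n}\frac{z^n}{n!}$ is the generalized hypergeometric series, where $(a)_n$ is the rising Pochhammer symbol. *)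

(* Defs.v *)
(* Real analysis over Stdlib's R, with Coquelicot's series: [is_series] and
   [ex_series] are convergence of the sequence of partial sums (no absolute
   convergence involved), [Series] is the limit. *)
From Stdlib Require Import Factorial Reals List.
From Coquelicot Require Import Coquelicot.
Open Scope R_scope.

(* Rising Pochhammer symbol (a)_n = a (a+1) ... (a+n-1). *)
Fixpoint pochhammer (a : R) (n : nat) : R :=
  match n with
  | O => 1
  | S m => pochhammer a m * (a + INR m)
  end.

Definition pochhammers (a : list R) (n : nat) : R :=
  fold_right Rmult 1 (map (fun x => pochhammer x n) a).

Definition hypergeometric_term (a b : list R) (z : R) (n : nat) : R :=
  pochhammers a n / pochhammers b n * (z ^ n / INR (fact n)).

(* pFq(a; b; z), with p and q the lengths of the lists a and b. *)
Definition hypergeometric (a b : list R) (z : R) : R :=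
  Series (hypergeometric_term a b z).

(* H_n = sum of 1/(2k+1) over 0 <= k <= n; [sum_f_R0 f n] has n+1 terms. *)
Definition odd_harmonic (n : nat) : R :=
  sum_f_R0 (fun k => / (2 * INR k + 1)) n.

(* The Riemann zeta function on its half-line of convergence s > 1. *)
Definition zeta (s : R) : R :=
  Series (fun n => / Rpower (INR n + 1) s).

(* The Dirichlet beta function at a positive integer s. *)
Definition dirichlet_beta (s : nat) : R :=
  Series (fun n => (-1) ^ n / (2 * INR n + 1) ^ s).

(* Main.v *)
(* For s = 1/2 + eps write 1/(n + s) as a finite combination of the moments
   of x^n against the shifted Legendre polynomials P_k(2x-1), whose coefficients
   are explicit products of factors (i + 1/2 - eps) / (i + 1/2 + eps) and hence,
   expanded in eps, polynomials in odd harmonic sums.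
   - Summing over n against (C(2n,n)/4^n)^2 (the coefficients of (2/PI) K(sqrt x))
     and taking the eps^2 term expresses the left-hand side through
     sum (-1)^k u_k (H_k^3 - H_{k-1}^3) and beta(4), where u_k = 1/(2k+1).
   - Summing against C(2n,n)/4^n (the coefficients of (1-x)^(-1/2)) and taking the
     eps^3 term expresses sum (-1)^k u_k (2 (H_k^3 + H_{k-1}^3) + O_k + O_{k-1}),
     O_k = sum_{i<=k} u_i^3, through the third logarithmic moment of a beta integral,
     which the shift s -> s + 1 evaluates in terms of log 2, PI^2 and zeta(3).
   - The linear sum with O_k is evaluated by a partial fraction expansion over the
     integers of the alternating kernel at half-integers.
   All interchanges of limits are instances of dominated convergence. *)

Require Import Defs.
From Stdlib Require Import Arith Reals List Lra Lia.
From Coquelicot Require Import Coquelicot.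
Import ListNotations.
Open Scope R_scope.

Local Arguments INR !n : simpl nomatch.

(** * Series as limits of partial sums *)

(** Two pairings are needed because each sees only a symmetrized quantity: order eps^2 gives the
    difference H_k^3 - H_{k-1}^3, order eps^3 gives the sum, and half of each isolates H_k^3.
    Harmonic sums enter through (1 - x)/(1 + x) = exp(-2 (x + x^3/3 + ...)): with H and O the sums
    of u_i and u_i^3 over i < K, the product is exp(-4 H eps - (16/3) O eps^3 - ...), so up to order
    3 no sum of squares occurs. The obstacle is that the series in k converges only conditionally,
    so it cannot be exchanged with the sum over n by absolute convergence. The k-sum is therefore
    cut at K. For fixed n the cut is exact as soon as K > n, because P_k is orthogonal to x^n for k
    > n; and it is bounded by a constant times log^3 n / n uniformly in K, which the decay n^(-1/2)
    of the binomial weights makes summable. The parameter eps is never a real variable: every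
    expansion in it is carried as a family of coefficients and verified coefficient by
    coefficient. *)

Fixpoint partial_sum (f : nat -> R) (n : nat) : R :=
  match n with
  | O => 0
  | S m => partial_sum f m + f m
  end.

Lemma sum_n_partial_sum (f : nat -> R) (n : nat) :
  sum_n f n = partial_sum f (S n).
Proof.
induction n as [|n IH].
- rewrite sum_O; simpl; ring.
- rewrite sum_Sn, IH; reflexivity.
Qed.

Lemma is_series_partial_sum (f : nat -> R) (l : R) :
  is_series f l <-> is_lim_seq (partial_sum f) l.
Proof.
split; intro H.
- apply is_lim_seq_incr_1.
  apply (is_lim_seq_ext (sum_n f)); [intro n; apply sum_n_partial_sum|exact H].
- apply is_lim_seq_incr_1 in H.
  apply (is_lim_seq_ext _ (sum_n f)) in H; [exact H|].
  intro n; symmetry; apply sum_n_partial_sum.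
Qed.

Lemma partial_sum_ext (f g : nat -> R) (n : nat) :
  (forall k, (k < n)%nat -> f k = g k) -> partial_sum f n = partial_sum g n.
Proof.
induction n as [|n IH]; intro H; simpl; [reflexivity|].
rewrite IH by (intros; apply H; lia).
rewrite H by lia; reflexivity.
Qed.

Lemma partial_sum_plus (f g : nat -> R) (n : nat) :
  partial_sum (fun k => f k + g k) n = partial_sum f n + partial_sum g n.
Proof. induction n as [|n IH]; simpl; [ring|rewrite IH; ring]. Qed.

Lemma partial_sum_scal (c : R) (f : nat -> R) (n : nat) :
  partial_sum (fun k => c * f k) n = c * partial_sum f n.
Proof. induction n as [|n IH]; simpl; [ring|rewrite IH; ring]. Qed.

Lemma partial_sum_telescope (g : nat -> R) (n : nat) :
  partial_sum (fun k => g (S k) - g k) n = g n - g O.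
Proof. induction n as [|n IH]; simpl; [ring|rewrite IH; ring]. Qed.

Lemma partial_sum_le (f g : nat -> R) (n : nat) :
  (forall k, f k <= g k) -> partial_sum f n <= partial_sum g n.
Proof.
intro H; induction n as [|n IH]; simpl; [lra|].
specialize (H n); lra.
Qed.

Lemma partial_sum_ge0 (f : nat -> R) (n : nat) :
  (forall k, 0 <= f k) -> 0 <= partial_sum f n.
Proof.
intro H; induction n as [|n IH]; simpl; [lra|].
specialize (H n); lra.
Qed.

Lemma partial_sum_incr (f : nat -> R) (m n : nat) :
  (forall k, 0 <= f k) -> (m <= n)%nat -> partial_sum f m <= partial_sum f n.
Proof.
intros H Hmn; induction Hmn as [|n Hmn IH]; simpl; [lra|].
specialize (H n); lra.
Qed.

Lemma is_series_telescope (g : nat -> R) (l : R) :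
  is_lim_seq g l -> is_series (fun k => g (S k) - g k) (l - g O).
Proof.
intro H; apply is_series_partial_sum.
apply (is_lim_seq_ext (fun n => g n - g O)).
- intro n; symmetry; apply partial_sum_telescope.
- apply is_lim_seq_minus'; [exact H|apply is_lim_seq_const].
Qed.

Lemma is_lim_seq_eq (u : nat -> R) (l l' : R) :
  is_lim_seq u l -> l = l' -> is_lim_seq u l'.
Proof. intros H <-; exact H. Qed.

Lemma is_series_eq (u : nat -> R) (l l' : R) :
  is_series u l -> l = l' -> is_series u l'.
Proof. intros H <-; exact H. Qed.

Lemma is_series_Rplus (u v : nat -> R) (a b : R) :
  is_series u a -> is_series v b -> is_series (fun n => u n + v n) (a + b).
Proof. exact (is_series_plus u v a b). Qed.

Lemma is_series_Rscal (c : R) (u : nat -> R) (a : R) :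
  is_series u a -> is_series (fun n => c * u n) (c * a).
Proof. exact (is_series_scal c u a). Qed.

Lemma ex_series_Rscal (c : R) (u : nat -> R) :
  ex_series u -> ex_series (fun n => c * u n).
Proof. exact (ex_series_scal c u). Qed.

Lemma is_series_Rext (u v : nat -> R) (a : R) :
  (forall n, u n = v n) -> is_series u a -> is_series v a.
Proof. exact (is_series_ext u v a). Qed.

Lemma ex_series_Rext (u v : nat -> R) :
  (forall n, u n = v n) -> ex_series u -> ex_series v.
Proof. exact (ex_series_ext u v). Qed.

Lemma is_series_unique_real (u : nat -> R) (a b : R) :
  is_series u a -> is_series u b -> a = b.
Proof.
intros Ha Hb.
rewrite <- (is_series_unique _ _ Ha), <- (is_series_unique _ _ Hb); reflexivity.
Qed.

Lemma is_lim_seq_unique_real (u : nat -> R) (a b : R) :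
  is_lim_seq u a -> is_lim_seq u b -> a = b.
Proof.
intros Ha Hb.
apply is_lim_seq_unique in Ha; apply is_lim_seq_unique in Hb.
rewrite Ha in Hb; injection Hb; auto.
Qed.

Lemma is_lim_seq_Rscal (c : R) (u : nat -> R) (l : R) :
  is_lim_seq u l -> is_lim_seq (fun n => c * u n) (c * l).
Proof. intro H; exact (is_lim_seq_scal_l u c l H). Qed.

Lemma ex_series_Rle (u v : nat -> R) :
  (forall n, Rabs (u n) <= v n) -> ex_series v -> ex_series u.
Proof. exact (ex_series_le u v). Qed.

Lemma ex_series_subtelescope (f g : nat -> R) (l : R) :
  (forall n, 0 <= f n) -> (forall n, f n <= g n - g (S n)) ->
  is_lim_seq g l -> ex_series f.
Proof.
intros Hf Hfg Hg.
apply (ex_series_Rle f (fun n => -1 * (g (S n) - g n))).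
- intro n; rewrite Rabs_pos_eq by apply Hf; specialize (Hfg n); lra.
- exists (-1 * (l - g O)).
  apply is_series_Rscal, is_series_telescope, Hg.
Qed.

(** Dominated convergence for series. The sum is cut where the tail of [b] is below eps/5: the
    finite head tends to 0 termwise, and the tail of the difference is at most twice that of [b]. *)
Lemma tannery (F : nat -> nat -> R) (f b : nat -> R) :
  (forall N n, Rabs (F N n) <= b n) -> ex_series b ->
  (forall n, is_lim_seq (fun N => F N n) (f n)) ->
  ex_series f /\ is_lim_seq (fun N => Series (F N)) (Series f).
Proof.
intros HF Hb Hf.
assert (Hfb : forall n, Rabs (f n) <= b n).
{ intro n.
  assert (H := is_lim_seq_abs _ _ (Hf n)); simpl in H.
  exact (is_lim_seq_le (fun N => Rabs (F N n)) (fun _ => b n) _ (b n)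
    (fun N => HF N n) H (is_lim_seq_const (b n))). }
assert (Ef : ex_series f) by exact (ex_series_Rle f b Hfb Hb).
split; [exact Ef|].
assert (EF : forall N, ex_series (F N)).
{ intro N; exact (ex_series_Rle (F N) b (HF N) Hb). }
apply is_lim_seq_spec; intro eps.
destruct Hb as [sb Hsb].
assert (Hlim := proj1 (is_series_partial_sum _ _) Hsb).
apply is_lim_seq_spec in Hlim.
assert (He : 0 < eps / 5) by (destruct eps; simpl; lra).
destruct (Hlim (mkposreal _ He)) as [M HM]; simpl in HM.
specialize (HM (S M) (Nat.le_succ_diag_r M)).
assert (Hhead : is_lim_seq
  (fun N => partial_sum (fun n => Rabs (F N n - f n)) (S M)) 0).
{ generalize (S M); intro K; induction K as [|K IH]; simpl.
  - apply is_lim_seq_const.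
  - apply (is_lim_seq_eq _ (0 + 0)); [|ring].
    apply is_lim_seq_plus'; [exact IH|].
    apply (is_lim_seq_eq _ (Rabs (f K - f K)));
      [|rewrite Rminus_diag, Rabs_R0; reflexivity].
    apply (is_lim_seq_abs _ (f K - f K)).
    apply is_lim_seq_minus'; [apply Hf|apply is_lim_seq_const]. }
apply is_lim_seq_spec in Hhead.
destruct (Hhead (mkposreal _ He)) as [N0 HN0]; simpl in HN0.
exists N0; intros N HN; specialize (HN0 N HN).
assert (Ed : ex_series (fun n => Rabs (F N n - f n))).
{ apply (ex_series_Rle _ (fun n => 2 * b n)).
  - intro n; rewrite Rabs_Rabsolu.
    specialize (HF N n); specialize (Hfb n).
    eapply Rle_trans; [apply Rabs_triang|]; rewrite Rabs_Ropp; lra.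
  - exists (2 * sb); apply is_series_Rscal, Hsb. }
rewrite <- (Series_minus _ _ (EF N) Ef).
eapply Rle_lt_trans; [apply Series_Rabs, Ed|].
change (Series (fun n => Rabs (F N n - f n)) < eps).
rewrite (Series_incr_n _ (S M) (Nat.lt_0_succ M) Ed).
rewrite <- sum_n_Reals, sum_n_partial_sum.
assert (Eb : ex_series b) by (exists sb; exact Hsb).
assert (Htail : Series (fun k => b (S M + k)%nat) = sb - partial_sum b (S M)).
{ assert (H := Series_incr_n b (S M) (Nat.lt_0_succ M) Eb).
  rewrite <- sum_n_Reals, sum_n_partial_sum, (is_series_unique _ _ Hsb) in H.
  simpl Nat.pred in H; lra. }
assert (Htd : Series (fun k => Rabs (F N (S M + k)%nat - f (S M + k)%nat))
  <= Series (fun k => 2 * b (S M + k)%nat)).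
{ apply Series_le.
  - intro k; split; [apply Rabs_pos|].
    specialize (HF N (S M + k)%nat); specialize (Hfb (S M + k)%nat).
    eapply Rle_trans; [apply Rabs_triang|]; rewrite Rabs_Ropp; lra.
  - apply (ex_series_Rscal 2 (fun k => b (S M + k)%nat)).
    apply -> (ex_series_incr_n b (S M)); exact Eb. }
rewrite Series_scal_l, Htail in Htd.
simpl Nat.pred.
rewrite Rminus_0_r in HN0.
assert (H1 := Rle_abs (partial_sum (fun n => Rabs (F N n - f n)) (S M))).
assert (H2 := Rle_abs (- (partial_sum b (S M) - sb))).
rewrite Rabs_Ropp in H2.
destruct eps as [e Hepos]; simpl in *; lra.
Qed.

Lemma is_series_partial_sum_swap (F : nat -> nat -> R) (c : nat -> R) :
  (forall k, is_series (F k) (c k)) ->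
  forall K, is_series (fun n => partial_sum (fun k => F k n) K) (partial_sum c K).
Proof.
intros H K; induction K as [|K IH]; simpl.
- apply is_series_partial_sum.
  apply (is_lim_seq_ext (fun _ => 0)); [|apply is_lim_seq_const].
  intro n; induction n as [|n IHn]; simpl; lra.
- apply is_series_Rplus; [exact IH|apply H].
Qed.

Lemma pos_INR_S (n : nat) : 0 < INR n + 1.
Proof. assert (H := pos_INR n); lra. Qed.

Lemma is_lim_seq_inv_INR_S : is_lim_seq (fun n => / (INR n + 1)) 0.
Proof.
apply (is_lim_seq_eq _ 0); [|reflexivity].
apply (is_lim_seq_ext (fun n => / INR (S n))); [intro n; rewrite S_INR; reflexivity|].
apply (is_lim_seq_incr_1 (fun n => / INR n)).
replace (Finite 0) with (Rbar_inv p_infty) by reflexivity.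
apply is_lim_seq_inv; [apply is_lim_seq_INR|discriminate].
Qed.

Lemma is_lim_seq_squeeze0 (u v : nat -> R) :
  (forall n, Rabs (u n) <= v n) -> is_lim_seq v 0 -> is_lim_seq u 0.
Proof.
intros H Hv; apply is_lim_seq_abs_0.
apply (is_lim_seq_le_le (fun _ => 0) _ v); [|apply is_lim_seq_const|exact Hv].
intro n; split; [apply Rabs_pos|apply H].
Qed.

(** * Odd reciprocals and central binomial weights *)

Definition odd_inv (k : nat) : R := / (2 * INR k + 1).

Lemma odd_inv_pos (k : nat) : 0 < odd_inv k.
Proof. apply Rinv_0_lt_compat; assert (H := pos_INR k); lra. Qed.

Lemma odd_inv_le1 (k : nat) : odd_inv k <= 1.
Proof.
unfold odd_inv; rewrite <- Rinv_1; apply Rinv_le_contravar; [lra|].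
assert (H := pos_INR k); lra.
Qed.

(** Only n terms: H_k is [harm (S k)] and H_{k-1} is [harm k], which makes sense also for k = 0. *)
Definition harm (n : nat) : R := partial_sum odd_inv n.

Definition harm3 (n : nat) : R := partial_sum (fun k => odd_inv k ^ 3) n.

Lemma odd_harmonic_harm (n : nat) : odd_harmonic n = harm (S n).
Proof.
unfold odd_harmonic, harm.
rewrite <- sum_n_Reals; apply sum_n_partial_sum.
Qed.

Lemma harm_ge0 (n : nat) : 0 <= harm n.
Proof. apply partial_sum_ge0; intro k; apply Rlt_le, odd_inv_pos. Qed.

Lemma harm3_bounds (n : nat) : 0 <= harm3 n <= harm n.
Proof.
split.
- apply partial_sum_ge0; intro k; apply pow_le, Rlt_le, odd_inv_pos.
- apply partial_sum_le; intro k.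
  assert (H := odd_inv_pos k); assert (H' := odd_inv_le1 k).
  nra.
Qed.

Lemma harm_incr (m n : nat) : (m <= n)%nat -> harm m <= harm n.
Proof. apply partial_sum_incr; intro k; apply Rlt_le, odd_inv_pos. Qed.

(* wallis n = C(2n, n) / 4^n *)
Fixpoint wallis (n : nat) : R :=
  match n with
  | O => 1
  | S m => wallis m * ((2 * INR m + 1) / (2 * INR m + 2))
  end.

Lemma wallis_pos (n : nat) : 0 < wallis n.
Proof.
induction n as [|n IH]; simpl; [lra|].
assert (H := pos_INR n).
apply Rmult_lt_0_compat; [exact IH|]; apply Rdiv_lt_0_compat; lra.
Qed.

Lemma wallis_succ (n : nat) :
  wallis (S n) * (INR n + 1) = wallis n * (INR n + 1 / 2).
Proof. assert (H := pos_INR n); simpl; field; lra. Qed.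

(** The left side decreases from 1, its successive ratios being (2n+1)(2n+3)/(2n+2)^2 < 1. This
    gives the decay n^(-1/2) without reference to PI. *)
Lemma wallis_sqr_le (n : nat) : wallis n ^ 2 * (2 * INR n + 1) <= 1.
Proof.
induction n as [|n IH]; [simpl; lra|].
assert (H := pos_INR n).
assert (H1 := wallis_pos n).
replace (wallis (S n) ^ 2 * (2 * INR (S n) + 1)) with
  (wallis n ^ 2 * (2 * INR n + 1) *
    ((2 * INR n + 1) * (2 * INR n + 3) / (2 * INR n + 2) ^ 2)).
2: { rewrite S_INR; simpl; field; lra. }
apply Rle_trans with (1 * 1); [|lra].
apply Rmult_le_compat; [nra| |exact IH|].
- apply Rlt_le, Rdiv_lt_0_compat; nra.
- apply Rle_div_l; [nra|]; nra.
Qed.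

Lemma wallis_le1 (n : nat) : wallis n <= 1.
Proof.
assert (H := pos_INR n); assert (H1 := wallis_pos n).
assert (H2 := wallis_sqr_le n); nra.
Qed.

Lemma is_lim_seq_wallis : is_lim_seq wallis 0.
Proof.
assert (H : is_lim_seq (fun n => sqrt (/ (INR n + 1))) 0).
{ apply (is_lim_seq_eq _ (sqrt 0)); [|apply sqrt_0].
  apply (is_lim_seq_continuous sqrt).
  - apply continuity_pt_sqrt; lra.
  - exact is_lim_seq_inv_INR_S. }
refine (is_lim_seq_squeeze0 _ _ _ H).
intro n; rewrite Rabs_pos_eq by (apply Rlt_le, wallis_pos).
assert (H1 := wallis_pos n); assert (H2 := pos_INR n).
rewrite <- (sqrt_pow2 (wallis n)) by lra.
apply sqrt_le_1_alt.
assert (H3 := wallis_sqr_le n).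
apply Rmult_le_reg_r with (INR n + 1); [lra|].
rewrite Rinv_l by lra; nra.
Qed.

(** The degree 3 is that of the eps^3 coefficient in the harmonic sums. The offset 6 ensures (1 +
    u/q)^3 < 1 + u for q >= 6 and 0 < u <= 1, so one step of the cube gains less than [wallis]
    loses. *)
Definition log_majorant (n : nat) : R := (6 + harm n) ^ 3.

Lemma log_majorant_ge (n : nat) : 6 + harm n <= log_majorant n.
Proof.
assert (H := harm_ge0 n); unfold log_majorant.
set (x := 6 + harm n); assert (6 <= x) by (unfold x; lra); clearbody x.
nra.
Qed.

(* Telescoping: the factor (6 + harm n)^3 grows too slowly to destroy the decay
   of wallis n, so wallis n * (6 + harm n)^3 decreases by at least 1/12 of the
   summand. *)
Lemma ex_series_wallis_log :
  ex_series (fun n => wallis n * log_majorant n / (INR n + 1)).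
Proof.
assert (Hstep : forall n, wallis n * log_majorant n / (INR n + 1) <=
  12 * (wallis n * log_majorant n) - 12 * (wallis (S n) * log_majorant (S n))).
{ intro n.
  assert (Hw := wallis_pos n).
  assert (Hh := harm_ge0 n).
  assert (Hu0 := odd_inv_pos n); assert (Hu1 := odd_inv_le1 n).
  assert (Hn := pos_INR n).
  assert (E : (2 * INR n + 1) / (2 * INR n + 2) = / (1 + odd_inv n)).
  { unfold odd_inv; field; lra. }
  assert (E' : / (INR n + 1) = 2 * odd_inv n / (1 + odd_inv n)).
  { unfold odd_inv; field; lra. }
  unfold Rdiv at 1; rewrite E'.
  unfold log_majorant, harm; simpl wallis; simpl partial_sum; fold (harm n).
  rewrite E.
  set (q := 6 + harm n).
  replace (6 + (harm n + odd_inv n)) with (q + odd_inv n) by (unfold q; ring).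
  assert (Hq : 6 <= q) by (unfold q; lra); clearbody q.
  clear E E'; generalize dependent (odd_inv n); intros u Hu0 Hu1.
  assert (K : 2 * u * q ^ 3 <= 12 * ((1 + u) * q ^ 3 - (q + u) ^ 3)).
  { assert (K1 : 6 * q ^ 2 <= q ^ 3) by nra.
    assert (K2 : 36 * q <= q ^ 3) by nra.
    assert (K3 : 216 <= q ^ 3) by nra.
    assert (u ^ 2 <= u) by nra.
    assert (u ^ 3 <= u) by nra.
    assert (u * (6 * q ^ 2) <= u * q ^ 3) by (apply Rmult_le_compat_l; lra).
    assert (u * (36 * q) <= u * q ^ 3) by (apply Rmult_le_compat_l; lra).
    assert (u * 216 <= u * q ^ 3) by (apply Rmult_le_compat_l; lra).
    assert (u ^ 2 * q <= u * q) by (apply Rmult_le_compat_r; lra).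
    replace ((q + u) ^ 3) with
      (q ^ 3 + 3 * (u * q ^ 2) + 3 * (u ^ 2 * q) + u ^ 3) by ring.
    lra. }
  apply Rmult_le_reg_r with (1 + u); [lra|].
  replace (wallis n * q ^ 3 * (2 * u / (1 + u)) * (1 + u))
    with (wallis n * (2 * u * q ^ 3)) by (field; lra).
  replace ((12 * (wallis n * q ^ 3) - 12 * (wallis n * / (1 + u) * (q + u) ^ 3))
    * (1 + u)) with (wallis n * (12 * ((1 + u) * q ^ 3 - (q + u) ^ 3)))
    by (field; lra).
  apply Rmult_le_compat_l; lra. }
assert (Hpos : forall n, 0 <= wallis n * log_majorant n).
{ intro n; apply Rmult_le_pos; [apply Rlt_le, wallis_pos|].
  assert (H := harm_ge0 n); apply pow_le; lra. }
assert (Hdiv : forall n, 0 <= wallis n * log_majorant n / (INR n + 1)).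
{ intro n; apply Rdiv_le_0_compat; [apply Hpos|apply pos_INR_S]. }
destruct (ex_finite_lim_seq_decr
  (fun n => 12 * (wallis n * log_majorant n)) 0) as [l Hl].
- intro n; specialize (Hstep n); specialize (Hdiv n); lra.
- intro n; specialize (Hpos n); lra.
- exact (ex_series_subtelescope _ _ l Hdiv Hstep Hl).
Qed.

(** * Shifted Legendre moments *)

Fixpoint legendre_prod (k n : nat) : R :=
  match k with
  | O => 1
  | S j => legendre_prod j n * ((INR n - INR j) / (INR n + INR j + 1))
  end.

(* The integral of x^n P_k(2x-1) over [0,1]. *)
Definition legendre_moment (k n : nat) : R :=
  legendre_prod k n / (INR n + INR k + 1).

(** Orthogonality of P_k to lower degrees: the factor with j = n vanishes. For fixed n every
    expansion in k is thus finite. *)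
Lemma legendre_prod_big (k n : nat) : (n < k)%nat -> legendre_prod k n = 0.
Proof.
induction k as [|k IH]; intro H; [lia|]; simpl.
destruct (Nat.eq_dec n k) as [->|Hne].
- unfold Rdiv; ring.
- rewrite IH by lia; ring.
Qed.

Lemma legendre_prod_bounds (k n : nat) : 0 <= legendre_prod k n <= 1.
Proof.
induction k as [|k IH]; [simpl; lra|].
destruct (le_lt_dec k n) as [Hle|Hlt].
- simpl; apply le_INR in Hle.
  assert (H := pos_INR k).
  assert (H1 : 0 <= (INR n - INR k) / (INR n + INR k + 1) <= 1).
  { split; [apply Rdiv_le_0_compat; lra|apply Rle_div_l; lra]. }
  nra.
- rewrite legendre_prod_big by lia; lra.
Qed.

Lemma legendre_prod_succ_r (k n : nat) :
  legendre_prod k (S n) * (INR n + 1 - INR k) =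
  legendre_prod k n * (INR n + 1) / (INR n + INR k + 1) * (INR n + 1).
Proof.
assert (Hn := pos_INR n).
induction k as [|k IH].
- simpl; field; lra.
- assert (Hk := pos_INR k).
  simpl legendre_prod; rewrite !S_INR.
  replace (legendre_prod k (S n) * ((INR n + 1 - INR k) / (INR n + 1 + INR k + 1))
     * (INR n + 1 - (INR k + 1)))
    with (legendre_prod k (S n) * (INR n + 1 - INR k) *
      ((INR n - INR k) / (INR n + INR k + 2))) by (field; lra).
  rewrite IH; field; lra.
Qed.

(** Moment form of the Legendre equation, the left factor being (n+1)(n+2) - k(k+1). It is not
    divided out because it vanishes at k = n + 1. *)
Lemma legendre_moment_succ_r (k n : nat) :
  legendre_moment k (S n) * ((INR n + 1 - INR k) * (INR n + INR k + 2)) =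
  legendre_moment k n * (INR n + 1) ^ 2.
Proof.
assert (Hn := pos_INR n); assert (Hk := pos_INR k).
unfold legendre_moment; rewrite S_INR.
replace (legendre_prod k (S n) / (INR n + 1 + INR k + 1) *
  ((INR n + 1 - INR k) * (INR n + INR k + 2)))
  with (legendre_prod k (S n) * (INR n + 1 - INR k)) by (field; lra).
rewrite legendre_prod_succ_r; field; lra.
Qed.

Lemma legendre_moment_succ_l (k n : nat) :
  legendre_moment (S k) n =
  legendre_moment k n * ((INR n - INR k) / (INR n + INR k + 2)).
Proof.
assert (Hn := pos_INR n); assert (Hk := pos_INR k).
unfold legendre_moment; simpl legendre_prod; rewrite S_INR; field; lra.
Qed.

(** Removes the boundary term at n = 0 of the telescoping sums below. *)
Lemma legendre_moment_0 (k : nat) : INR k * legendre_moment k 0 = 0.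
Proof.
destruct k as [|k]; [simpl; ring|].
unfold legendre_moment; rewrite legendre_prod_big by lia; unfold Rdiv; ring.
Qed.

Lemma is_lim_seq_inv_shift (c : R) :
  is_lim_seq (fun n => / (INR n + c)) 0.
Proof.
replace (Finite 0) with (Rbar_inv p_infty) by reflexivity.
apply is_lim_seq_inv; [|discriminate].
eapply is_lim_seq_plus; [apply is_lim_seq_INR|apply is_lim_seq_const|reflexivity].
Qed.

Lemma is_lim_seq_ratio (a b : R) :
  is_lim_seq (fun n => (INR n + a) / (INR n + b)) 1.
Proof.
apply (is_lim_seq_ext_loc (fun n => 1 + (a - b) * / (INR n + b))).
- destruct (INR_unbounded (Rabs b)) as [N HN].
  exists N; intros n Hn; apply le_INR in Hn.
  assert (H := Rle_abs (- b)); rewrite Rabs_Ropp in H; field; lra.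
- apply (is_lim_seq_eq _ (1 + (a - b) * 0)); [|ring].
  apply is_lim_seq_plus'; [apply is_lim_seq_const|].
  apply is_lim_seq_Rscal, is_lim_seq_inv_shift.
Qed.

Lemma is_lim_seq_legendre_prod (k : nat) :
  is_lim_seq (fun n => legendre_prod k n) 1.
Proof.
induction k as [|k IH]; simpl; [apply is_lim_seq_const|].
apply (is_lim_seq_eq _ (1 * 1)); [|ring].
apply is_lim_seq_mult'; [exact IH|].
apply (is_lim_seq_ext (fun n => (INR n + - INR k) / (INR n + (INR k + 1)))).
- intro n; unfold Rdiv, Rminus; rewrite Rplus_assoc; reflexivity.
- apply is_lim_seq_ratio.
Qed.

(* Integrated Legendre equation: x(1-x)K' turns the sum over n into a boundary term. *)
Lemma is_series_wallis_sqr_moment (k : nat) (L : R) :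
  is_lim_seq (fun n => wallis n ^ 2 * (INR n + 1)) L ->
  is_series (fun n => wallis n ^ 2 * legendre_moment k n)
    (4 * L * odd_inv k ^ 2).
Proof.
intro HL.
assert (Hk := pos_INR k).
(* The increment of [G] is (k + 1/2)^2 times the summand, since (n + 1/2)^2 - (n - k)(n + k + 1) =
   (k + 1/2)^2. *)
set (G := fun n => wallis n ^ 2 * ((INR n - INR k) * (INR n + INR k + 1))
  * legendre_moment k n).
assert (HG : is_lim_seq G L).
{ apply (is_lim_seq_ext (fun n => wallis n ^ 2 * (INR n + 1) *
    (legendre_prod k n * ((INR n + - INR k) / (INR n + 1))))).
  - intro n; assert (Hn := pos_INR n).
    unfold G, legendre_moment; field; lra.
  - apply (is_lim_seq_eq _ (L * (1 * 1))); [|ring].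
    apply is_lim_seq_mult'; [exact HL|].
    apply is_lim_seq_mult'; [apply is_lim_seq_legendre_prod|apply is_lim_seq_ratio]. }
apply is_series_telescope in HG.
apply (is_series_Rscal (4 * odd_inv k ^ 2)) in HG.
apply (is_series_eq _ (4 * odd_inv k ^ 2 * (L - G O))).
2: { unfold G; assert (E := legendre_moment_0 k).
  replace (wallis 0 ^ 2 * ((INR 0 - INR k) * (INR 0 + INR k + 1)) *
    legendre_moment k 0) with
    (- (INR k * legendre_moment k 0) * (INR k + 1)) by (simpl; ring).
  rewrite E; ring. }
revert HG; apply is_series_Rext; intro n.
assert (Hn := pos_INR n); unfold G.
assert (E := legendre_moment_succ_r k n).
assert (Ew := wallis_succ n).
replace (wallis (S n) ^ 2 * ((INR (S n) - INR k) * (INR (S n) + INR k + 1)) *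
  legendre_moment k (S n)) with
  ((wallis (S n) * (INR n + 1)) ^ 2 * legendre_moment k n).
- rewrite Ew; unfold odd_inv; field; lra.
- rewrite S_INR.
  replace ((wallis (S n) * (INR n + 1)) ^ 2 * legendre_moment k n) with
   (wallis (S n) ^ 2 * (legendre_moment k n * (INR n + 1) ^ 2)) by ring.
  rewrite <- E; ring.
Qed.

(** The integral of (1-x)^(-1/2) P_k(2x-1) over [0,1]. For k = 0 it telescopes by w_n/(n+1) = 2 (w_n
    - w_{n+1}), w being [wallis]; the passage from k to k + 1 telescopes in n as well. *)
Lemma is_series_wallis_moment (k : nat) :
  is_series (fun n => wallis n * legendre_moment k n) (2 * odd_inv k).
Proof.
induction k as [|k IH].
- assert (H := is_series_Rscal (-2) _ _ (is_series_telescope _ _ is_lim_seq_wallis)).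
  apply (is_series_eq _ (-2 * (0 - wallis 0))).
  2: { unfold odd_inv; simpl; field. }
  revert H; apply is_series_Rext; intro n; assert (Hn := pos_INR n).
  unfold legendre_moment; simpl; field; lra.
- assert (Hk := pos_INR k).
  (* Zeilberger certificate for (2k+3) m_{k+1} - (2k+1) m_k *)
  set (G := fun n => -4 * (INR n - INR k) * wallis n * legendre_moment k n).
  assert (HG : is_lim_seq G 0).
  { apply (is_lim_seq_ext (fun n => -4 * (wallis n *
      (legendre_prod k n * ((INR n + - INR k) / (INR n + (INR k + 1))))))).
    - intro n; assert (Hn := pos_INR n).
      unfold G, legendre_moment; field; lra.
    - apply (is_lim_seq_eq _ (-4 * (0 * (1 * 1)))); [|ring].
      apply is_lim_seq_Rscal, is_lim_seq_mult'; [exact is_lim_seq_wallis|].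
      apply is_lim_seq_mult'; [apply is_lim_seq_legendre_prod|apply is_lim_seq_ratio]. }
  apply is_series_telescope in HG.
  assert (H := is_series_Rscal (odd_inv (S k)) _ _
    (is_series_Rplus _ _ _ _ HG (is_series_Rscal (2 * INR k + 1) _ _ IH))).
  apply (is_series_eq _ _ (2 * odd_inv (S k))) in H.
  2: { unfold G.
    replace (-4 * (INR 0 - INR k) * wallis 0 * legendre_moment k 0)
      with (4 * (INR k * legendre_moment k 0)) by (simpl; ring).
    rewrite legendre_moment_0; unfold odd_inv; rewrite S_INR; field; lra. }
  revert H; apply is_series_Rext; intro n.
  assert (Hn := pos_INR n); unfold G.
  assert (E := legendre_moment_succ_r k n).
  replace (-4 * (INR (S n) - INR k) * wallis (S n) * legendre_moment k (S n)) with
    (-4 * (wallis (S n) * (INR n + 1)) * legendre_moment k n * (INR n + 1)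
      / (INR n + INR k + 2)).
  + rewrite wallis_succ, legendre_moment_succ_l; unfold odd_inv; rewrite S_INR.
    field; lra.
  + rewrite S_INR.
    replace (-4 * (wallis (S n) * (INR n + 1)) * legendre_moment k n * (INR n + 1)
      / (INR n + INR k + 2)) with (-4 * wallis (S n) *
      (legendre_moment k n * (INR n + 1) ^ 2) / (INR n + INR k + 2)) by (field; lra).
    rewrite <- E; field; lra.
Qed.

(** * Expansion of 1/(n + 1/2 + eps) to third order in eps *)

(* prod_coef j K is the coefficient of eps^j in
   prod_(i < K) (i + 1/2 - eps) / (i + 1/2 + eps), for j <= 3 only. *)
Definition prod_coef (j K : nat) : R :=
  match j with
  | 0%nat => 1
  | 1%nat => -4 * harm K
  | 2%nat => 8 * harm K ^ 2
  | _ => - (32 * harm K ^ 3 + 16 * harm3 K) / 3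
  end.

(* The same product divided by K + 1/2 + eps. *)
Definition moment_coef (j K : nat) : R :=
  let u := odd_inv K in
  let h := harm K in
  match j with
  | 0%nat => 2 * u
  | 1%nat => 2 * u * (-4 * h - 2 * u)
  | 2%nat => 2 * u * (8 * h ^ 2 + 8 * h * u + 4 * u ^ 2)
  | _ => 2 * u * (- (32 * h ^ 3 + 16 * harm3 K) / 3 - 16 * h ^ 2 * u
                  - 16 * h * u ^ 2 - 8 * u ^ 3)
  end.

Definition legendre_partial (j n K : nat) : R :=
  partial_sum (fun k => (-1) ^ k * (2 * INR k + 1) * moment_coef j k
    * legendre_moment k n) K.

(** The eps^j coefficient of 1 - (n + 1/2 + eps) S_K, where S_K is the Legendre expansion of 1/(n +
    1/2 + eps) cut after K terms. *)
Definition remainder (j n K : nat) : R :=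
  (-1) ^ K * legendre_prod K n * prod_coef j K.

Lemma legendre_partial_succ (j n K : nat) :
  legendre_partial j n (S K) = legendre_partial j n K +
    (-1) ^ K * (2 * INR K + 1) * moment_coef j K * legendre_moment K n.
Proof. reflexivity. Qed.

(* Christoffel-Darboux summation, coefficient by coefficient in eps. *)
Lemma legendre_partial_0 (n K : nat) :
  (INR n + 1 / 2) * legendre_partial 0 n K = 1 - remainder 0 n K.
Proof.
assert (Hn := pos_INR n).
induction K as [|K IH].
- unfold legendre_partial, remainder, prod_coef; simpl; ring.
- assert (Hk := pos_INR K).
  rewrite legendre_partial_succ, Rmult_plus_distr_l, IH.
  unfold remainder, moment_coef, prod_coef, legendre_moment, odd_inv.
  simpl pow; simpl legendre_prod; field; lra.
Qed.

(** Coefficient of eps^(j+1) in (n + 1/2 + eps) S_K = 1 - R_K. The bound on j reflects that the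
    coefficient tables are genuine only up to order 3. *)
Lemma legendre_partial_S (j n K : nat) : (j < 3)%nat ->
  (INR n + 1 / 2) * legendre_partial (S j) n K + legendre_partial j n K =
  - remainder (S j) n K.
Proof.
intro Hj.
assert (Hn := pos_INR n).
induction K as [|K IH].
- destruct j as [|[|[|j]]]; [| | |lia];
  unfold legendre_partial, remainder, prod_coef, harm, harm3; simpl; field.
- assert (Hk := pos_INR K).
  rewrite !legendre_partial_succ.
  match goal with |- ?x * (?A + ?a) + (?B + ?b) = _ =>
    transitivity ((x * A + B) + (x * a + b)); [ring|] end.
  rewrite IH.
  destruct j as [|[|[|j]]]; [| | |lia];
  unfold remainder, moment_coef, prod_coef, legendre_moment, harm, harm3;
  simpl partial_sum; simpl legendre_prod; fold (harm K); fold (harm3 K);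
  unfold odd_inv; simpl pow; field; lra.
Qed.

Lemma legendre_partial_big (j n K : nat) : (j < 4)%nat -> (n < K)%nat ->
  legendre_partial j n K = (-1) ^ j / (INR n + 1 / 2) ^ S j.
Proof.
intros Hj HK; assert (Hn := pos_INR n).
assert (Hx : INR n + 1 / 2 <> 0) by lra.
assert (Hr : forall i, remainder i n K = 0).
{ intro i; unfold remainder; rewrite legendre_prod_big by exact HK; ring. }
induction j as [|j IH].
- assert (H := legendre_partial_0 n K); rewrite Hr in H.
  apply (Rmult_eq_reg_l (INR n + 1 / 2)); [|exact Hx].
  rewrite H; simpl; field; lra.
- assert (H := legendre_partial_S j n K ltac:(lia)); rewrite Hr, IH in H by lia.
  apply (Rmult_eq_reg_l (INR n + 1 / 2)); [|exact Hx].
  transitivity (- ((-1) ^ j / (INR n + 1 / 2) ^ S j)); [lra|].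
  generalize dependent (INR n + 1 / 2); intros x Hx _ _.
  simpl; field; split; [apply pow_nonzero; exact Hx|exact Hx].
Qed.

Lemma prod_coef_bound (j n K : nat) : (K <= n)%nat ->
  Rabs (prod_coef j K) <= 16 * log_majorant n.
Proof.
intro HK.
assert (H0 := harm_ge0 K); assert (H1 := harm_incr K n HK).
assert (H3 := harm3_bounds K).
unfold log_majorant, prod_coef; set (q := 6 + harm n).
assert (Hq : harm K <= q - 6) by (unfold q; lra).
assert (Hq6 : 6 <= q) by (unfold q; lra); clearbody q.
generalize dependent (harm K); intros h H0 H1 H3 Hq.
assert (Hh2 : h ^ 2 <= q ^ 2) by (apply pow_incr; lra).
assert (Hh3 : h ^ 3 <= q ^ 3) by (apply pow_incr; lra).
assert (Hp2 : 0 <= h ^ 2) by (apply pow_le; lra).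
assert (Hp3 : 0 <= h ^ 3) by (apply pow_le; lra).
assert (Hq2 : q <= q ^ 2) by nra.
assert (Hq3 : q ^ 2 <= q ^ 3) by nra.
destruct j as [|[|[|j]]]; apply Rabs_le; lra.
Qed.

(** Uniform in K although [harm K] is unbounded: the product vanishes for K > n, so only [harm K]
    with K <= n ever contributes, and it is at most [harm n]. *)
Lemma remainder_bound (j n K : nat) :
  Rabs (remainder j n K) <= 16 * log_majorant n.
Proof.
assert (HL : 0 <= log_majorant n).
{ assert (H := log_majorant_ge n); assert (H' := harm_ge0 n); lra. }
unfold remainder.
destruct (le_lt_dec K n) as [HK|HK].
- rewrite !Rabs_mult, pow_1_abs, Rmult_1_l.
  assert (H := legendre_prod_bounds K n).
  rewrite (Rabs_pos_eq (legendre_prod K n)) by lra.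
  assert (H1 := prod_coef_bound j n K HK).
  assert (H2 := Rabs_pos (prod_coef j K)); nra.
- rewrite legendre_prod_big by exact HK.
  rewrite Rmult_0_r, Rmult_0_l, Rabs_R0; lra.
Qed.

(** The coefficient recursion is solved for the next order; each division by n + 1/2 costs a factor
    2/(n + 1). The constants for j = 0, 1, 2, 3 come out as 34, 100, 232 and 496. *)
Lemma legendre_partial_bound (j n K : nat) : (j < 4)%nat ->
  Rabs (legendre_partial j n K) <= 1000 * (log_majorant n / (INR n + 1)).
Proof.
intro Hj; assert (Hn := pos_INR n).
assert (HL : 6 <= log_majorant n).
{ assert (H := log_majorant_ge n); assert (H' := harm_ge0 n); lra. }
set (y := log_majorant n / (INR n + 1)).
assert (Hdiv : forall a r, 0 <= r -> Rabs ((INR n + 1 / 2) * a) <= r * log_majorant n ->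
  Rabs a <= 2 * r * y).
{ intros a r Hr Ha; rewrite Rabs_mult, (Rabs_pos_eq (INR n + 1 / 2)) in Ha by lra.
  unfold y; apply Rmult_le_reg_l with (INR n + 1); [lra|].
  replace ((INR n + 1) * (2 * r * (log_majorant n / (INR n + 1))))
    with (2 * (r * log_majorant n)) by (field; lra).
  assert (Ha0 := Rabs_pos a); nra. }
assert (Hy : y <= log_majorant n).
{ unfold y; apply Rle_div_l; [lra|]; nra. }
assert (Hy0 : 0 <= y) by (unfold y; apply Rdiv_le_0_compat; lra).
assert (Hr : forall i, Rabs (remainder i n K) <= 16 * log_majorant n)
  by (intro i; apply remainder_bound).
assert (B0 : Rabs (legendre_partial 0 n K) <= 34 * y).
{ apply (Hdiv _ 17); [lra|].
  rewrite legendre_partial_0.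
  eapply Rle_trans; [apply Rabs_triang|].
  rewrite Rabs_R1, Rabs_Ropp; specialize (Hr 0%nat); lra. }
assert (Hstep : forall i r, (i < 3)%nat -> 0 <= r -> Rabs (legendre_partial i n K) <= r * y ->
  Rabs (legendre_partial (S i) n K) <= 2 * (16 + r) * y).
{ intros i r Hi Hr0 Hb; apply (Hdiv _ (16 + r)); [lra|].
  assert (H := legendre_partial_S i n K Hi).
  replace ((INR n + 1 / 2) * legendre_partial (S i) n K) with
    (- remainder (S i) n K + - legendre_partial i n K) by lra.
  eapply Rle_trans; [apply Rabs_triang|].
  assert (Hry := Rmult_le_compat_l r _ _ Hr0 Hy).
  rewrite !Rabs_Ropp; specialize (Hr (S i)); lra. }
assert (B1 := Hstep 0%nat 34 ltac:(lia) ltac:(lra) B0).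
assert (B2 := Hstep 1%nat (2 * (16 + 34)) ltac:(lia) ltac:(lra) B1).
assert (B3 := Hstep 2%nat (2 * (16 + 2 * (16 + 34))) ltac:(lia) ltac:(lra) B2).
destruct j as [|[|[|[|j]]]]; [| | | |lia]; lra.
Qed.

(* Legendre expansion of the function with power series coefficients b,
   paired with the derivatives of x^(eps - 1/2) at eps = 0. *)
Lemma legendre_pairing (j : nat) (b c : nat -> R) : (j < 4)%nat ->
  (forall n, Rabs (b n) <= wallis n) ->
  (forall k, is_series (fun n => b n * legendre_moment k n) (c k)) ->
  ex_series (fun n => b n / (INR n + 1 / 2) ^ S j) /\
  is_series (fun k => (-1) ^ k * (2 * INR k + 1) * moment_coef j k * c k)
    ((-1) ^ j * Series (fun n => b n / (INR n + 1 / 2) ^ S j)).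
Proof.
intros Hj Hb Hc.
(* Only the finite sum over k < K is exchanged with the series over n; as K grows, each term in n
   becomes constant once K > n. *)
destruct (tannery (fun K n => b n * legendre_partial j n K)
  (fun n => b n * ((-1) ^ j / (INR n + 1 / 2) ^ S j))
  (fun n => 1000 * (wallis n * log_majorant n / (INR n + 1)))) as [Hex Hlim].
- intros K n.
  assert (H := legendre_partial_bound j n K Hj).
  rewrite Rabs_mult.
  replace (1000 * (wallis n * log_majorant n / (INR n + 1)))
    with (wallis n * (1000 * (log_majorant n / (INR n + 1))))
    by (field; apply Rgt_not_eq, pos_INR_S).
  apply Rmult_le_compat; [apply Rabs_pos|apply Rabs_pos|apply Hb|exact H].
- apply (ex_series_Rscal 1000), ex_series_wallis_log.
- intro n; apply (is_lim_seq_ext_loc (fun _ => b n * ((-1) ^ j / (INR n + 1 / 2) ^ S j))).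
  + exists (S n); intros K HK.
    rewrite legendre_partial_big by (exact Hj || lia); reflexivity.
  + apply is_lim_seq_const.
- assert (Hsgn : (-1) ^ j * (-1) ^ j = 1).
  { rewrite <- pow_add; replace (j + j)%nat with (2 * j)%nat by lia.
    apply pow_1_even. }
  split.
  + apply (ex_series_Rscal ((-1) ^ j)) in Hex.
    revert Hex; apply ex_series_Rext; intro n.
    transitivity ((-1) ^ j * (-1) ^ j * (b n / (INR n + 1 / 2) ^ S j)).
    * unfold Rdiv; ring.
    * rewrite Hsgn; ring.
  + apply is_series_partial_sum.
    apply (is_lim_seq_eq _ (Series (fun n => b n * ((-1) ^ j / (INR n + 1 / 2) ^ S j)))).
    2: { rewrite <- Series_scal_l; apply Series_ext; intro n; unfold Rdiv; ring. }
    revert Hlim; apply is_lim_seq_ext; intro K.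
    apply is_series_unique.
    assert (H := is_series_partial_sum_swap
      (fun k n => (-1) ^ k * (2 * INR k + 1) * moment_coef j k *
        (b n * legendre_moment k n)) _
      (fun k => is_series_Rscal _ _ _ (Hc k)) K).
    revert H; apply is_series_Rext; intro n.
    unfold legendre_partial; rewrite <- partial_sum_scal.
    apply partial_sum_ext; intros k _; ring.
Qed.

(** * Wallis integrals and the Basel sum *)

Definition trig_int (p m : nat) : R :=
  RInt (fun x => x ^ p * cos x ^ m) 0 (PI / 2).

Lemma continuous_pow_cos (p m : nat) (x : R) :
  continuous (fun x => x ^ p * cos x ^ m) x.
Proof.
apply (ex_derive_continuous (fun x => x ^ p * cos x ^ m)); auto_derive; trivial.
Qed.

Lemma is_RInt_trig (p m : nat) :
  is_RInt (fun x => x ^ p * cos x ^ m) 0 (PI / 2) (trig_int p m).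
Proof.
apply (RInt_correct (fun x => x ^ p * cos x ^ m)).
apply (ex_RInt_continuous (fun x => x ^ p * cos x ^ m)).
intros; apply continuous_pow_cos.
Qed.

Lemma is_RInt_Rlin (f g : R -> R) (a b c d A B : R) :
  is_RInt f a b A -> is_RInt g a b B ->
  is_RInt (fun x => c * f x + d * g x) a b (c * A + d * B).
Proof.
intros Hf Hg.
exact (is_RInt_plus _ _ a b _ _ (is_RInt_scal f a b c A Hf) (is_RInt_scal g a b d B Hg)).
Qed.

Lemma is_RInt_unique_real (f : R -> R) (a b A B : R) :
  is_RInt f a b A -> is_RInt f a b B -> A = B.
Proof.
intros HA HB.
rewrite <- (is_RInt_unique f a b A HA), <- (is_RInt_unique f a b B HB); reflexivity.
Qed.

Lemma cos_ge0_half (x : R) : 0 <= x <= PI / 2 -> 0 <= cos x <= 1.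
Proof.
intro Hx; split; [apply cos_ge_0; lra|apply COS_bound].
Qed.

Lemma trig_int_rec (m : nat) :
  (INR m + 2) * trig_int 0 (S (S m)) = (INR m + 1) * trig_int 0 m.
Proof.
assert (H : is_RInt (fun x => (INR m + 2) * (x ^ 0 * cos x ^ S (S m)) +
  - (INR m + 1) * (x ^ 0 * cos x ^ m)) 0 (PI / 2)
  (sin (PI / 2) * cos (PI / 2) ^ S m - sin 0 * cos 0 ^ S m)).
{ apply (is_RInt_derive (fun x => sin x * cos x ^ S m)).
  - intros x _; auto_derive; [trivial|].
    assert (E := sin2_cos2 x); unfold Rsqr in E.
    rewrite S_INR; simpl pow.
    (* The two sides differ by a multiple of 1 - sin^2 - cos^2. *)
    apply Rminus_diag_uniq.
    transitivity ((1 - (sin x * sin x + cos x * cos x)) * ((INR m + 1) * cos x ^ m)).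
    + ring.
    + rewrite E; ring.
  - intros x _.
    apply (ex_derive_continuous (fun x => (INR m + 2) * (x ^ 0 * cos x ^ S (S m)) +
      - (INR m + 1) * (x ^ 0 * cos x ^ m))); auto_derive; trivial. }
assert (H' := is_RInt_Rlin _ _ _ _ (INR m + 2) (- (INR m + 1)) _ _
  (is_RInt_trig 0 (S (S m))) (is_RInt_trig 0 m)).
assert (E := is_RInt_unique_real _ _ _ _ _ H H').
rewrite cos_PI2, sin_0 in E; simpl pow in E; lra.
Qed.

(** Two integrations by parts of cos^(2n+2), as in Matsuoka's proof of the Basel sum, condensed into
    the single antiderivative x cos^(2n+2) x + (n+1) x^2 sin x cos^(2n+1) x. *)
Lemma trig_int_basel_rec (n : nat) :
  2 * (INR n + 1) ^ 2 * trig_int 2 (2 * n + 2)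
    - (INR n + 1) * (2 * INR n + 1) * trig_int 2 (2 * n)
    + trig_int 0 (2 * n + 2) = 0.
Proof.
set (m := (2 * n)%nat).
assert (Hm : INR m = 2 * INR n) by (unfold m; rewrite mult_INR; reflexivity).
replace (m + 2)%nat with (S (S m)) by lia.
set (c := INR n + 1) in *.
assert (H : is_RInt (fun x => 1 * (2 * c ^ 2 * (x ^ 2 * cos x ^ S (S m)) +
  - (c * (2 * INR n + 1)) * (x ^ 2 * cos x ^ m)) + 1 * (x ^ 0 * cos x ^ S (S m)))
  0 (PI / 2)
  ((PI / 2 * cos (PI / 2) ^ S (S m) + c * ((PI / 2) ^ 2 * sin (PI / 2) * cos (PI / 2) ^ S m))
   - (0 * cos 0 ^ S (S m) + c * (0 ^ 2 * sin 0 * cos 0 ^ S m)))).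
{ apply (is_RInt_derive (fun x => x * cos x ^ S (S m) + c * (x ^ 2 * sin x * cos x ^ S m))).
  - intros x _; auto_derive; [trivial|].
    assert (E := sin2_cos2 x); unfold Rsqr in E.
    rewrite !S_INR, Hm; simpl pow; unfold c.
    apply Rminus_diag_uniq.
    transitivity ((1 - (sin x * sin x + cos x * cos x)) *
       ((INR n + 1) * (2 * INR n + 1) * x * x * cos x ^ m)).
    + ring.
    + rewrite E; ring.
  - intros x _.
    apply (ex_derive_continuous (fun x => 1 * (2 * c ^ 2 * (x ^ 2 * cos x ^ S (S m)) +
  - (c * (2 * INR n + 1)) * (x ^ 2 * cos x ^ m)) + 1 * (x ^ 0 * cos x ^ S (S m)))).
    auto_derive; trivial. }
assert (H' := is_RInt_Rlin _ _ _ _ 1 1 _ _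
  (is_RInt_Rlin _ _ _ _ (2 * c ^ 2) (- (c * (2 * INR n + 1))) _ _
    (is_RInt_trig 2 (S (S m))) (is_RInt_trig 2 m)) (is_RInt_trig 0 (S (S m)))).
assert (E := is_RInt_unique_real _ _ _ _ _ H H').
rewrite cos_PI2, sin_0 in E; simpl pow in E |- *; lra.
Qed.

Lemma trig_int_decr (m : nat) : trig_int 0 (S m) <= trig_int 0 m.
Proof.
apply (is_RInt_le (fun x => x ^ 0 * cos x ^ S m) (fun x => x ^ 0 * cos x ^ m)
  0 (PI / 2)); [apply Rlt_le, PI2_RGT_0|apply is_RInt_trig|apply is_RInt_trig|].
intros x Hx; assert (H := cos_ge0_half x ltac:(lra)).
assert (H1 := pow_le (cos x) m (proj1 H)); simpl; nra.
Qed.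

Lemma trig_int_even (n : nat) : trig_int 0 (2 * n) = PI / 2 * wallis n.
Proof.
induction n as [|n IH].
- unfold trig_int; simpl.
  apply is_RInt_unique.
  replace (PI / 2 * 1) with (PI / 2 - 0) by ring.
  apply (is_RInt_derive (fun x => x)).
  + intros x _; auto_derive; [trivial|ring].
  + intros x _; apply continuous_const.
- assert (Hn := pos_INR n).
  assert (H := trig_int_rec (2 * n)).
  replace (2 * S n)%nat with (S (S (2 * n))) by lia.
  rewrite IH, mult_INR in H.
  change (INR 2) with 2 in H.
  apply (Rmult_eq_reg_l (2 * INR n + 2)); [|lra].
  rewrite H; simpl; field; lra.
Qed.

Lemma trig_int_odd (n : nat) :
  trig_int 0 (2 * n + 1) = / ((2 * INR n + 1) * wallis n).
Proof.
induction n as [|n IH].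
- unfold trig_int; simpl.
  apply is_RInt_unique.
  replace (/ ((2 * 0 + 1) * 1)) with (sin (PI / 2) - sin 0)
    by (rewrite sin_PI2, sin_0; field).
  apply (is_RInt_derive sin).
  + intros x _; auto_derive; [trivial|ring].
  + intros x _; apply (ex_derive_continuous (fun x => 1 * (cos x * 1))).
    auto_derive; trivial.
- assert (Hn := pos_INR n); assert (Hw := wallis_pos n).
  assert (H := trig_int_rec (2 * n + 1)).
  replace (2 * S n + 1)%nat with (S (S (2 * n + 1))) by lia.
  rewrite IH, plus_INR, mult_INR in H.
  change (INR 2) with 2 in H; change (INR 1) with 1 in H.
  apply (Rmult_eq_reg_l (2 * INR n + 1 + 2)); [|lra].
  rewrite H, S_INR; simpl; field; lra.
Qed.

(** The integrals of cos^m decrease in m. Comparing m = 2n, 2n+1, 2n+2 and multiplying by (2n+1)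
    [wallis n] gives both bounds. *)
Lemma wallis_sqr_sandwich (n : nat) :
  / PI * ((INR n + 1) / (INR n + 1 / 2)) <= wallis n ^ 2 * (INR n + 1) <=
  / PI * ((INR n + 1) / (INR n + 1 / 2)) * ((INR n + 1) / (INR n + 1 / 2)).
Proof.
assert (Hn := pos_INR n); assert (Hw := wallis_pos n); assert (HP := PI_RGT_0).
assert (H1 := trig_int_decr (2 * n)).
assert (H2 := trig_int_decr (S (2 * n))).
replace (S (S (2 * n))) with (2 * S n)%nat in H2 by lia.
replace (S (2 * n)) with (2 * n + 1)%nat in * by lia.
rewrite trig_int_even, trig_int_odd in H1, H2.
apply (Rmult_le_compat_r ((2 * INR n + 1) * wallis n)) in H1; [|nra].
apply (Rmult_le_compat_r ((2 * INR n + 1) * wallis n)) in H2; [|nra].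
rewrite Rinv_l in H1, H2 by nra.
simpl wallis in H2.
split.
- apply (Rmult_le_reg_r (PI * (INR n + 1 / 2))); [nra|].
  replace (/ PI * ((INR n + 1) / (INR n + 1 / 2)) * (PI * (INR n + 1 / 2)))
    with (INR n + 1) by (field; lra).
  replace (wallis n ^ 2 * (INR n + 1) * (PI * (INR n + 1 / 2))) with
   ((INR n + 1) * (PI / 2 * wallis n * ((2 * INR n + 1) * wallis n))) by field.
  nra.
- apply (Rmult_le_reg_r (PI * (INR n + 1 / 2) ^ 2 / (INR n + 1) ^ 2)).
  { apply Rdiv_lt_0_compat; [|nra]; apply Rmult_lt_0_compat; nra. }
  replace (/ PI * ((INR n + 1) / (INR n + 1 / 2)) * ((INR n + 1) / (INR n + 1 / 2)) *
    (PI * (INR n + 1 / 2) ^ 2 / (INR n + 1) ^ 2)) with 1 by (field; lra).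
  eapply Rle_trans; [|exact H2]; right; field; lra.
Qed.

Lemma is_lim_seq_wallis_sqr :
  is_lim_seq (fun n => wallis n ^ 2 * (INR n + 1)) (/ PI).
Proof.
apply (is_lim_seq_le_le _ _ _ _ wallis_sqr_sandwich).
- apply (is_lim_seq_eq _ (/ PI * 1)); [|ring].
  apply is_lim_seq_Rscal, is_lim_seq_ratio.
- apply (is_lim_seq_eq _ (/ PI * 1 * 1)); [|ring].
  apply is_lim_seq_mult'; [apply is_lim_seq_Rscal|]; apply is_lim_seq_ratio.
Qed.

Lemma x_cos_le_sin (x : R) : 0 <= x <= PI / 2 -> x * cos x <= sin x.
Proof.
intro Hx.
destruct (MVT_gen (fun y => sin y - y * cos y) 0 x (fun y => y * sin y)) as [c [Hc E]].
- intros y _; auto_derive; [trivial|ring].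
- intros y _; apply continuity_pt_filterlim.
  apply (ex_derive_continuous (fun y => sin y - y * cos y)); auto_derive; trivial.
- rewrite Rmin_left, Rmax_right in Hc by lra.
  rewrite sin_0 in E.
  assert (Hs : 0 <= sin c) by (apply sin_ge_0; lra).
  assert (0 <= c * sin c * (x - 0)) by (repeat apply Rmult_le_pos; lra).
  lra.
Qed.

(** From x cos x <= sin x one gets x^2 cos^(m+2) x <= cos^m x - cos^(m+2) x, whose integral is known
    from the recursion. *)
Lemma trig_int_2_bound (n : nat) :
  0 <= trig_int 2 (2 * n + 2) <= trig_int 0 (2 * n + 2) / (2 * INR n + 1).
Proof.
assert (Hn := pos_INR n).
set (m := (2 * n)%nat); replace (m + 2)%nat with (S (S m)) by lia.
assert (H := trig_int_rec m).
assert (Hm : INR m = 2 * INR n) by (unfold m; rewrite mult_INR; reflexivity).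
rewrite Hm in H.
split.
- apply (is_RInt_le (fun _ => 0) (fun x => x ^ 2 * cos x ^ S (S m)) 0 (PI / 2));
    [apply Rlt_le, PI2_RGT_0| |apply is_RInt_trig|].
  + assert (H0 := is_RInt_const 0 (PI / 2) (0 : R)).
    unfold scal in H0; simpl in H0; unfold mult in H0; simpl in H0.
    rewrite Rmult_0_r in H0; exact H0.
  + intros x Hx; assert (Hc := cos_ge0_half x ltac:(lra)).
    apply Rmult_le_pos; [apply pow2_ge_0|apply pow_le; lra].
- apply Rle_trans with (1 * trig_int 0 m + -1 * trig_int 0 (S (S m))).
  2: { right; apply (Rmult_eq_reg_l (2 * INR n + 1)); [|lra].
       field_simplify; [|lra]; lra. }
  eapply (is_RInt_le (fun x => x ^ 2 * cos x ^ S (S m)) _ 0 (PI / 2));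
    [apply Rlt_le, PI2_RGT_0|apply is_RInt_trig
    |exact (is_RInt_Rlin _ _ _ _ 1 (-1) _ _ (is_RInt_trig 0 m) (is_RInt_trig 0 (S (S m))))|].
  intros x Hx; assert (Hc := cos_ge0_half x ltac:(lra)).
  assert (Hs := x_cos_le_sin x ltac:(lra)).
  assert (E := sin2_cos2 x); unfold Rsqr in E.
  assert (Hp := pow_le (cos x) m (proj1 Hc)).
  assert (K : (x * cos x) ^ 2 <= 1 - cos x ^ 2).
  { replace (1 - cos x ^ 2) with (sin x ^ 2) by (simpl; lra).
    apply pow_incr; split; [apply Rmult_le_pos; lra|exact Hs]. }
  apply (Rmult_le_compat_l _ _ _ Hp) in K.
  simpl in *; lra.
Qed.

(** The quotient r_n of the integrals of x^2 cos^(2n) x and cos^(2n) x satisfies r_{n+1} - r_n =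
    -1/(2 (n+1)^2), with r_0 = PI^2/12 and limit 0. *)
Lemma is_series_zeta2 : is_series (fun n => / (INR n + 1) ^ 2) (PI ^ 2 / 6).
Proof.
assert (HP := PI_RGT_0).
set (r := fun n => trig_int 2 (2 * n) / trig_int 0 (2 * n)).
assert (HI : forall n, 0 < trig_int 0 (2 * n)).
{ intro n; rewrite trig_int_even; assert (Hw := wallis_pos n); nra. }
assert (Hr : is_lim_seq r 0).
{ apply is_lim_seq_incr_1.
  apply (is_lim_seq_squeeze0 _ (fun n => / 2 * / (INR n + 1 / 2))).
  - intro n; assert (Hn := pos_INR n); unfold r.
    assert (H := trig_int_2_bound n); specialize (HI (S n)).
    replace (2 * n + 2)%nat with (2 * S n)%nat in H by lia.
    rewrite Rabs_pos_eq by (apply Rdiv_le_0_compat; lra).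
    apply Rle_div_l; [exact HI|].
    eapply Rle_trans; [apply H|]; right; field; lra.
  - apply (is_lim_seq_eq _ (/ 2 * 0)); [|ring].
    apply is_lim_seq_Rscal, is_lim_seq_inv_shift. }
assert (H := is_series_Rscal (-2) _ _ (is_series_telescope _ _ Hr)).
apply (is_series_eq _ (-2 * (0 - r O))).
- revert H; apply is_series_Rext; intro n.
  assert (Hn := pos_INR n).
  assert (Hb := trig_int_basel_rec n).
  assert (Hb' := trig_int_rec (2 * n)).
  replace (2 * n + 2)%nat with (2 * S n)%nat in Hb by lia.
  replace (S (S (2 * n))) with (2 * S n)%nat in Hb' by lia.
  rewrite mult_INR in Hb'; change (INR 2) with 2 in Hb'.
  assert (H1 := HI n); assert (H2 := HI (S n)); unfold r.
  set (I0 := trig_int 0 (2 * n)) in *; set (I1 := trig_int 0 (2 * S n)) in *.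
  set (J0 := trig_int 2 (2 * n)) in *; set (J1 := trig_int 2 (2 * S n)) in *.
  assert (E1 : I0 = (2 * INR n + 2) / (2 * INR n + 1) * I1).
  { apply (Rmult_eq_reg_l (2 * INR n + 1)); [|lra]; rewrite <- Hb'; field; lra. }
  assert (E2 : J1 = ((INR n + 1) * (2 * INR n + 1) * J0 - I1) / (2 * (INR n + 1) ^ 2)).
  { apply (Rmult_eq_reg_l (2 * (INR n + 1) ^ 2)); [|nra]; field_simplify; [|lra]; lra. }
  rewrite E2, E1; field; lra.
- assert (E0 := trig_int_even 0); simpl in E0.
  unfold r; simpl; rewrite E0; unfold trig_int; simpl.
  rewrite (is_RInt_unique (fun x => x * (x * 1) * 1) 0 (PI / 2)
    ((PI / 2) ^ 3 / 3 - 0 ^ 3 / 3)).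
  + field; lra.
  + apply (is_RInt_derive (fun x => x ^ 3 / 3)).
    * intros x _; auto_derive; [trivial|field].
    * intros x _; apply (ex_derive_continuous (fun x => x * (x * 1) * 1)).
      auto_derive; trivial.
Qed.

(** * Values of zeta, and log 2 *)

Lemma partial_sum_even_odd (f : nat -> R) (n : nat) :
  partial_sum f (2 * n) = partial_sum (fun k => f (2 * k)%nat + f (2 * k + 1)%nat) n.
Proof.
induction n as [|n IH]; [reflexivity|].
replace (2 * S n)%nat with (S (S (2 * n))) by lia.
change (partial_sum f (2 * n) + f (2 * n)%nat + f (S (2 * n)) =
  partial_sum (fun k => f (2 * k)%nat + f (2 * k + 1)%nat) n +
  (f (2 * n)%nat + f (2 * n + 1)%nat)).
rewrite IH; replace (2 * n + 1)%nat with (S (2 * n)) by lia; ring.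
Qed.

Lemma is_series_even_odd (f : nat -> R) (l : R) :
  is_series f l -> is_series (fun k => f (2 * k)%nat + f (2 * k + 1)%nat) l.
Proof.
intro H; apply is_series_partial_sum.
apply is_series_partial_sum in H.
apply (is_lim_seq_ext (fun n => partial_sum f (2 * n)));
  [intro n; apply partial_sum_even_odd|].
apply (is_lim_seq_subseq (partial_sum f) l (fun n => (2 * n)%nat)); [|exact H].
apply eventually_subseq; intro n; lia.
Qed.

(** Index n stands for the denominator n + 1, so even indices carry the odd denominators; the even
    denominators add up to z / 2^p. *)
Lemma is_series_odd_inv_pow (p : nat) (z : R) :
  is_series (fun n => / (INR n + 1) ^ p) z ->
  is_series (fun k => odd_inv k ^ p) (z - z / 2 ^ p).
Proof.
intro H.
assert (H1 := is_series_Rplus _ _ _ _ (is_series_even_odd _ _ H)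
  (is_series_Rscal (- / 2 ^ p) _ _ H)).
apply (is_series_eq _ (z + - / 2 ^ p * z)); [|unfold Rdiv; ring].
revert H1; apply is_series_Rext; intro k; assert (Hk := pos_INR k).
rewrite plus_INR, !mult_INR; change (INR 2) with 2; change (INR 1) with 1.
replace (2 * INR k + 1 + 1) with (2 * (INR k + 1)) by ring.
rewrite Rpow_mult_distr, Rinv_mult.
unfold odd_inv; rewrite pow_inv; ring.
Qed.

Lemma is_series_zeta3 : is_series (fun n => / (INR n + 1) ^ 3) (zeta 3).
Proof.
assert (E : ex_series (fun n => / (INR n + 1) ^ 3)).
{ apply (ex_series_Rle _ (fun n => / (INR n + 1) ^ 2)).
  - intro n; assert (Hn := pos_INR n).
    rewrite Rabs_pos_eq by (apply Rlt_le, Rinv_0_lt_compat; nra).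
    apply Rinv_le_contravar; nra.
  - eexists; exact is_series_zeta2. }
replace (zeta 3) with (Series (fun n => / (INR n + 1) ^ 3)).
- apply Series_correct, E.
- apply Series_ext; intro n.
  replace 3 with (INR 3) by (simpl; ring).
  rewrite Rpower_pow by apply pos_INR_S; reflexivity.
Qed.

Lemma is_series_odd_inv_sqr : is_series (fun k => odd_inv k ^ 2) (PI ^ 2 / 8).
Proof.
eapply is_series_eq; [apply is_series_odd_inv_pow, is_series_zeta2|]; field.
Qed.

Lemma is_series_odd_inv_cube : is_series (fun k => odd_inv k ^ 3) (7 / 8 * zeta 3).
Proof.
eapply is_series_eq; [apply is_series_odd_inv_pow, is_series_zeta3|]; field.
Qed.

Lemma ln_succ_bounds (n : nat) :
  / (INR n + 2) <= ln (INR n + 2) - ln (INR n + 1) <= / (INR n + 1).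
Proof.
assert (Hn := pos_INR n).
rewrite <- ln_div by lra.
split.
- assert (H := exp_ineq1_le (- / (INR n + 2))).
  apply Rle_trans with (- ln ((INR n + 1) / (INR n + 2))).
  + apply Ropp_le_cancel; rewrite Ropp_involutive.
    rewrite <- (ln_exp (- / (INR n + 2))).
    apply ln_le; [apply Rdiv_lt_0_compat; lra|].
    eapply Rle_trans; [|exact H]; right; field; lra.
  + rewrite !ln_div by lra; lra.
- assert (H := exp_ineq1_le (/ (INR n + 1))).
  rewrite <- (ln_exp (/ (INR n + 1))).
  apply ln_le; [apply Rdiv_lt_0_compat; lra|].
  eapply Rle_trans; [|exact H]; right; field; lra.
Qed.

(** Euler's constant. Its existence suffices: the value cancels when the n-th term is subtracted
    from the 2n-th to obtain ln 2. *)
Lemma ex_lim_harmonic_minus_ln : exists gamma : R,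
  is_lim_seq (fun n => partial_sum (fun k => / (INR k + 1)) n - ln (INR n + 1)) gamma.
Proof.
set (e := fun n => partial_sum (fun k => / (INR k + 1)) n - ln (INR n + 1)).
(* Adding 1/(n+1) turns the increasing sequence into a decreasing one, which makes the upper bound
   inductive. *)
assert (Hb : forall n, e n + / (INR n + 1) <= 1).
{ induction n as [|n IH].
  - unfold e; simpl; rewrite Rplus_0_l, ln_1; lra.
  - unfold e in *; simpl partial_sum; rewrite S_INR.
    assert (H := ln_succ_bounds n).
    replace (INR n + 1 + 1) with (INR n + 2) by ring.
    lra. }
destruct (ex_finite_lim_seq_incr e 1) as [g Hg].
- intro n; unfold e; simpl partial_sum; rewrite S_INR.
  assert (H := ln_succ_bounds n).
  replace (INR n + 1 + 1) with (INR n + 2) by ring; lra.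
- intro n; specialize (Hb n).
  assert (H := Rinv_0_lt_compat _ (pos_INR_S n)); lra.
- exists g; exact Hg.
Qed.

Lemma is_series_ln2 :
  is_series (fun k => / (2 * INR k + 1) - / (2 * INR k + 2)) (ln 2).
Proof.
destruct ex_lim_harmonic_minus_ln as [g Hg].
set (f := fun k => / (INR k + 1)) in Hg.
assert (H2 := is_lim_seq_subseq _ g (fun n => (2 * n)%nat)
  (eventually_subseq (fun n => (2 * n)%nat) ltac:(intro n; cbv beta; lia)) Hg).
assert (H := is_lim_seq_minus' _ _ _ _ H2 Hg).
assert (Hln : is_lim_seq (fun n => ln (2 - / (INR n + 1))) (ln 2)).
{ apply (is_lim_seq_continuous ln).
  - apply continuity_pt_filterlim, (continuous_ln 2); lra.
  - apply (is_lim_seq_eq _ (2 - 0)); [|ring].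
    apply is_lim_seq_minus'; [apply is_lim_seq_const|exact is_lim_seq_inv_INR_S]. }
apply is_series_partial_sum.
apply (is_lim_seq_eq _ (g - g + ln 2)); [|ring].
assert (H' := is_lim_seq_plus' _ _ _ _ H Hln).
revert H'; apply is_lim_seq_ext; intro n.
assert (Hn := pos_INR n).
replace (2 - / (INR n + 1)) with ((2 * INR n + 1) / (INR n + 1)) by (field; lra).
rewrite ln_div by lra.
rewrite mult_INR; change (INR 2) with 2.
rewrite partial_sum_even_odd.
replace (partial_sum f n) with (1 * partial_sum f n) by ring.
match goal with |- ?A - ?a - (1 * ?B - ?b) + (?a' - ?b') = _ =>
  transitivity (A + -1 * B); [ring|] end.
rewrite <- partial_sum_scal, <- partial_sum_plus.
apply partial_sum_ext; intros k _; assert (Hk := pos_INR k).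
unfold f; rewrite plus_INR, mult_INR; change (INR 2) with 2; change (INR 1) with 1.
field; lra.
Qed.

(** * Moments of (1-x)^(-1/2) against powers of the logarithm *)

(* The coefficient of (-eps)^j in sum_n wallis n / (n + s + eps). *)
Definition wallis_sum (j : nat) (s : R) : R :=
  Series (fun n => wallis n / (INR n + s) ^ S j).

Lemma ex_series_wallis_shift (j : nat) (s : R) : 1 / 2 <= s ->
  ex_series (fun n => wallis n / (INR n + s) ^ S j).
Proof.
intro Hs.
apply (ex_series_Rle _ (fun n => 2 ^ S j * (wallis n * log_majorant n / (INR n + 1)))).
2: apply ex_series_Rscal, ex_series_wallis_log.
intro n; assert (Hn := pos_INR n); assert (Hw := wallis_pos n).
assert (HL : 1 <= log_majorant n).
{ assert (H := log_majorant_ge n); assert (H' := harm_ge0 n); lra. }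
assert (Hp : 0 < (INR n + s) ^ S j) by (apply pow_lt; lra).
rewrite Rabs_pos_eq by (apply Rdiv_le_0_compat; lra).
assert (H2 : INR n + 1 <= 2 ^ S j * (INR n + s) ^ S j).
{ rewrite <- Rpow_mult_distr.
  apply Rle_trans with ((INR n + 1) ^ S j); [|apply pow_incr; lra].
  assert (H1 := pow_R1_Rle (INR n + 1) j ltac:(lra)); simpl; nra. }
apply Rle_div_l; [exact Hp|].
replace (2 ^ S j * (wallis n * log_majorant n / (INR n + 1)) * (INR n + s) ^ S j)
  with (wallis n * (log_majorant n * (2 ^ S j * (INR n + s) ^ S j / (INR n + 1))))
  by (field; lra).
rewrite <- (Rmult_1_r (wallis n)) at 1; apply Rmult_le_compat_l; [lra|].
assert (H3 : 1 <= 2 ^ S j * (INR n + s) ^ S j / (INR n + 1))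
  by (apply Rle_div_r; lra).
nra.
Qed.

Lemma is_series_wallis_sum (j : nat) (s : R) : 1 / 2 <= s ->
  is_series (fun n => wallis n / (INR n + s) ^ S j) (wallis_sum j s).
Proof. intro Hs; apply Series_correct, ex_series_wallis_shift, Hs. Qed.

Lemma is_lim_seq_wallis_shift (j : nat) (s : R) : 1 / 2 <= s ->
  is_lim_seq (fun n => INR n * wallis n / (INR n + s) ^ S j) 0.
Proof.
intro Hs.
apply (is_lim_seq_squeeze0 _ wallis); [|exact is_lim_seq_wallis].
intro n; assert (Hw := wallis_pos n).
destruct n as [|n].
- simpl INR; unfold Rdiv; rewrite !Rmult_0_l, Rabs_R0; lra.
- rewrite S_INR; assert (Hn := pos_INR n).
  assert (H1 := pow_R1_Rle (INR n + 1 + s) j ltac:(lra)).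
  assert (Hp : 0 < (INR n + 1 + s) ^ S j) by (apply pow_lt; lra).
  rewrite Rabs_pos_eq by (apply Rdiv_le_0_compat; [apply Rmult_le_pos|]; lra).
  apply Rle_div_l; [exact Hp|].
  rewrite Rmult_comm; apply Rmult_le_compat_l; [lra|].
  simpl; nra.
Qed.

Lemma wallis_shift_term (j n : nat) (s : R) : 1 / 2 <= s ->
  INR (S n) * wallis (S n) / (INR (S n) + s) ^ S j =
  wallis n * (INR n + 1 / 2) / (INR n + (s + 1)) ^ S j.
Proof.
intro Hs; assert (Hn := pos_INR n).
replace (INR n + (s + 1)) with (INR (S n) + s) by (rewrite S_INR; ring).
rewrite <- wallis_succ, S_INR; unfold Rdiv; ring.
Qed.

(** Since [wallis_sum 0 s] is the beta integral B(s, 1/2), this is its functional equation. It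
    follows by telescoping n w_n/(n + s), with (n+1) w_{n+1} = (n + 1/2) w_n. *)
Lemma wallis_sum_shift_0 (s : R) : 1 / 2 <= s ->
  s * wallis_sum 0 s = (s + 1 / 2) * wallis_sum 0 (s + 1).
Proof.
intro Hs.
assert (H := is_series_telescope _ _ (is_lim_seq_wallis_shift 0 s Hs)).
assert (H' := is_series_Rplus _ _ _ _ H (is_series_Rscal (s + 1 / 2) _ _
  (is_series_wallis_sum 0 (s + 1) ltac:(lra)))).
assert (H2 := is_series_Rscal s _ _ (is_series_wallis_sum 0 s Hs)).
apply (is_series_unique_real _ _ _ H2).
apply (is_series_eq _ _ ((s + 1 / 2) * wallis_sum 0 (s + 1))) in H'.
- revert H'; apply is_series_Rext; intro n; assert (Hn := pos_INR n).
  rewrite wallis_shift_term by exact Hs; simpl; field; lra.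
- simpl INR; unfold Rdiv; ring.
Qed.

(** The same functional equation at s + eps, read off at (-eps)^(j+1). *)
Lemma wallis_sum_shift_S (j : nat) (s : R) : 1 / 2 <= s ->
  s * wallis_sum (S j) s - wallis_sum j s =
  (s + 1 / 2) * wallis_sum (S j) (s + 1) - wallis_sum j (s + 1).
Proof.
intro Hs.
assert (H := is_series_telescope _ _ (is_lim_seq_wallis_shift (S j) s Hs)).
assert (H1 := is_series_Rplus _ _ _ _
  (is_series_Rscal (s + 1 / 2) _ _ (is_series_wallis_sum (S j) (s + 1) ltac:(lra)))
  (is_series_Rscal (-1) _ _ (is_series_wallis_sum j (s + 1) ltac:(lra)))).
assert (H2 := is_series_Rplus _ _ _ _
  (is_series_Rscal s _ _ (is_series_wallis_sum (S j) s ltac:(lra)))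
  (is_series_Rscal (-1) _ _ (is_series_wallis_sum j s ltac:(lra)))).
assert (H' := is_series_Rplus _ _ _ _ H1 H).
transitivity (s * wallis_sum (S j) s + -1 * wallis_sum j s); [ring|].
apply (is_series_unique_real _ _ _ H2).
apply (is_series_eq _ _ ((s + 1 / 2) * wallis_sum (S j) (s + 1)
  - wallis_sum j (s + 1))) in H'.
- revert H'; apply is_series_Rext; intro n; assert (Hn := pos_INR n).
  rewrite wallis_shift_term by exact Hs.
  assert (Hp : (INR n + (s + 1)) ^ j <> 0) by (apply pow_nonzero; lra).
  assert (Hp' : (INR n + s) ^ j <> 0) by (apply pow_nonzero; lra).
  simpl; field; repeat split; lra || assumption.
- simpl INR; unfold Rdiv; ring.
Qed.

Lemma wallis_sum_pos (j : nat) (s : R) : 1 / 2 <= s -> 0 < wallis_sum j s.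
Proof.
intro Hs.
assert (E := ex_series_wallis_shift j s Hs).
unfold wallis_sum; rewrite Series_incr_1 by exact E.
apply Rplus_lt_le_0_compat.
- apply Rdiv_lt_0_compat; [apply wallis_pos|apply pow_lt; simpl; lra].
- apply (ex_series_incr_1 (fun n => wallis n / (INR n + s) ^ S j)) in E.
  apply Rle_trans with (Series (fun _ : nat => 0 * 0)).
  + rewrite Series_scal_l; lra.
  + apply Series_le; [|exact E].
    intro n; split; [lra|]; rewrite Rmult_0_l.
    apply Rdiv_le_0_compat; [apply Rlt_le, wallis_pos|].
    apply pow_lt; assert (H := pos_INR (S n)); lra.
Qed.

Lemma wallis_sum_decr (s t : R) : 1 / 2 <= s -> s <= t ->
  wallis_sum 0 t <= wallis_sum 0 s.
Proof.
intros Hs Hst; apply Series_le; [|apply ex_series_wallis_shift, Hs].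
intro n; assert (Hn := pos_INR n); assert (Hw := wallis_pos n); simpl.
rewrite !Rmult_1_r; split.
- apply Rdiv_le_0_compat; lra.
- apply Rmult_le_compat_l; [lra|]; apply Rinv_le_contravar; lra.
Qed.

Lemma wallis_sum_le (j : nat) (s : R) : 1 / 2 <= s ->
  wallis_sum j s <= wallis_sum 0 s / s ^ j.
Proof.
intro Hs; unfold Rdiv; rewrite Rmult_comm; unfold wallis_sum at 2.
rewrite <- Series_scal_l.
assert (Hsj : 0 < s ^ j) by (apply pow_lt; lra).
apply Series_le.
2: apply (ex_series_Rscal (/ s ^ j)), ex_series_wallis_shift, Hs.
intro n; assert (Hn := pos_INR n); assert (Hw := wallis_pos n).
assert (Hp : 0 < (INR n + s) ^ j) by (apply pow_lt; lra).
assert (Hle : s ^ j <= (INR n + s) ^ j) by (apply pow_incr; lra).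
split.
- apply Rdiv_le_0_compat; [lra|apply pow_lt; lra].
- simpl; rewrite Rmult_1_r.
  replace (wallis n / ((INR n + s) * (INR n + s) ^ j)) with
    (/ (INR n + s) ^ j * (wallis n / (INR n + s))) by (field; lra).
  apply Rmult_le_compat_r; [apply Rdiv_le_0_compat; lra|].
  apply Rinv_le_contravar; lra.
Qed.

(** * Beta integrals at half-integers and integers *)

Lemma wallis_sum_half_shift (n : nat) :
  wallis_sum 0 (INR n + 1 / 2) = wallis_sum 0 (1 / 2) * wallis n.
Proof.
induction n as [|n IH]; [simpl; rewrite Rplus_0_l; ring|].
assert (Hn := pos_INR n).
assert (H := wallis_sum_shift_0 (INR n + 1 / 2) ltac:(lra)).
rewrite IH in H; rewrite S_INR.
replace (INR n + 1 + 1 / 2) with (INR n + 1 / 2 + 1) by ring.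
apply (Rmult_eq_reg_l (INR n + 1 / 2 + 1 / 2)); [|lra].
rewrite <- H; simpl; field; lra.
Qed.

Lemma wallis_sum_int_shift (n : nat) :
  wallis_sum 0 (INR n + 1) = / ((INR n + 1 / 2) * wallis n).
Proof.
induction n as [|n IH].
- simpl; rewrite Rplus_0_l.
  assert (H := is_series_Rscal (-2) _ _ (is_series_telescope _ _ is_lim_seq_wallis)).
  assert (E : wallis_sum 0 1 = -2 * (0 - wallis 0)).
  { apply (is_series_unique_real _ _ _ (is_series_wallis_sum 0 1 ltac:(lra))).
    revert H; apply is_series_Rext; intro n; assert (Hn := pos_INR n).
    simpl; field; lra. }
  rewrite E; simpl; field.
- assert (Hn := pos_INR n); assert (Hw := wallis_pos n).
  assert (H := wallis_sum_shift_0 (INR n + 1) ltac:(lra)).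
  rewrite IH in H; rewrite S_INR.
  apply (Rmult_eq_reg_l (INR n + 1 + 1 / 2)); [|lra].
  rewrite <- H; simpl; field; lra.
Qed.

(** B(s, 1/2) decreases in s, so the explicit values at the integers n + 1 are squeezed between
    those at n + 1/2 and n + 3/2, which carry the unknown factor B(1/2, 1/2). The Wallis limit then
    forces this factor to be PI. *)
Lemma wallis_sum_half : wallis_sum 0 (1 / 2) = PI.
Proof.
set (P := wallis_sum 0 (1 / 2)).
assert (HP := PI_RGT_0).
assert (HP0 : 0 < P) by (apply wallis_sum_pos; lra).
assert (Hlow : forall n, 1 <= P * (wallis n ^ 2 * (INR n + 1)) *
  ((INR n + 1 / 2) / (INR n + 1))).
{ intro n; assert (Hn := pos_INR n); assert (Hw := wallis_pos n).
  assert (H := wallis_sum_decr (INR n + 1 / 2) (INR n + 1) ltac:(lra) ltac:(lra)).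
  rewrite wallis_sum_half_shift, wallis_sum_int_shift in H; fold P in H.
  apply (Rmult_le_compat_r ((INR n + 1 / 2) * wallis n)) in H; [|nra].
  rewrite Rinv_l in H by nra.
  eapply Rle_trans; [exact H|]; right; field; lra. }
assert (Hupp : forall n, P * (wallis n ^ 2 * (INR n + 1)) *
  ((INR n + 1 / 2) / (INR n + 1)) * ((INR n + 1 / 2) / (INR n + 1)) <= 1).
{ intro n; assert (Hn := pos_INR n); assert (Hw := wallis_pos n).
  assert (H := wallis_sum_decr (INR n + 1) (INR (S n) + 1 / 2) ltac:(lra)
    ltac:(rewrite S_INR; lra)).
  rewrite wallis_sum_half_shift, wallis_sum_int_shift in H; fold P in H.
  apply (Rmult_le_compat_r ((INR n + 1 / 2) * wallis n)) in H; [|nra].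
  rewrite Rinv_l in H by nra.
  eapply Rle_trans; [|exact H]; right; simpl; field; lra. }
assert (L1 := is_lim_seq_Rscal P _ _ is_lim_seq_wallis_sqr).
assert (L2 := is_lim_seq_mult' _ _ _ _ L1 (is_lim_seq_ratio (1 / 2) 1)).
assert (L3 := is_lim_seq_mult' _ _ _ _ L2 (is_lim_seq_ratio (1 / 2) 1)).
assert (K1 := is_lim_seq_le _ _ _ _ Hlow (is_lim_seq_const 1) L2).
assert (K2 := is_lim_seq_le _ _ _ _ Hupp L3 (is_lim_seq_const 1)).
simpl in K1, K2.
apply (Rmult_eq_reg_r (/ PI)); [|apply Rinv_neq_0_compat; lra].
rewrite Rinv_r by lra; lra.
Qed.

(** By the shift, B(1/2 + eps, 1/2) / B(n + 1/2 + eps, 1/2) is the product over k < n of (k + 1 +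
    eps)/(k + 1/2 + eps). Up to its value at eps = 0 it equals exp of the sum over p of
    [power_diff p n] (-eps)^p / p. *)
Definition power_diff (p n : nat) : R :=
  partial_sum (fun k => / (INR k + 1 / 2) ^ p - / (INR k + 1) ^ p) n.

Lemma power_diff_succ (p n : nat) : power_diff p (S n) =
  power_diff p n + (/ (INR n + 1 / 2) ^ p - / (INR n + 1) ^ p).
Proof. reflexivity. Qed.

Lemma is_lim_seq_power_diff (p : nat) (z : R) :
  is_series (fun n => / (INR n + 1) ^ p) z ->
  is_lim_seq (power_diff p) ((2 ^ p - 2) * z).
Proof.
intro H; apply is_series_partial_sum.
assert (H2 : 2 ^ p <> 0) by (apply pow_nonzero; lra).
assert (H1 := is_series_Rplus _ _ _ _
  (is_series_Rscal (2 ^ p) _ _ (is_series_odd_inv_pow _ _ H)) (is_series_Rscal (-1) _ _ H)).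
apply (is_series_eq _ (2 ^ p * (z - z / 2 ^ p) + -1 * z)); [|field; exact H2].
revert H1; apply is_series_Rext; intro k; assert (Hk := pos_INR k).
unfold odd_inv.
replace (2 * INR k + 1) with (2 * (INR k + 1 / 2)) by field.
rewrite pow_inv, Rpow_mult_distr; field; repeat split; try apply pow_nonzero; lra.
Qed.

(** Kept apart from p > 1: the two power sums diverge separately, and their difference is twice the
    alternating series of ln 2. *)
Lemma is_lim_seq_power_diff_1 : is_lim_seq (power_diff 1) (2 * ln 2).
Proof.
apply is_series_partial_sum.
assert (H := is_series_Rscal 2 _ _ is_series_ln2).
revert H; apply is_series_Rext; intro k; assert (Hk := pos_INR k); simpl; field; lra.
Qed.

Definition wallis_ratio (j n : nat) : R :=
  wallis_sum j (INR n + 1 / 2) / wallis_sum 0 (INR n + 1 / 2).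

(** Each extra power of 1/(m + s) is at most 1/s, so the normalized higher coefficients vanish at
    infinity and the power sums alone survive. *)
Lemma is_lim_seq_wallis_ratio (j : nat) : is_lim_seq (wallis_ratio (S j)) 0.
Proof.
apply is_lim_seq_incr_1.
apply (is_lim_seq_squeeze0 _ (fun n => / (INR n + 1))); [|exact is_lim_seq_inv_INR_S].
intro n; assert (Hn := pos_INR n); unfold wallis_ratio.
set (s := INR (S n) + 1 / 2).
assert (Hs : INR n + 1 <= s) by (unfold s; rewrite S_INR; lra).
assert (H0 := wallis_sum_pos 0 s ltac:(lra)).
assert (Hj := wallis_sum_pos (S j) s ltac:(lra)).
assert (Hle := wallis_sum_le (S j) s ltac:(lra)).
rewrite Rabs_pos_eq by (apply Rlt_le, Rdiv_lt_0_compat; lra).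
apply Rle_div_l; [exact H0|].
eapply Rle_trans; [exact Hle|].
unfold Rdiv; rewrite Rmult_comm; apply Rmult_le_compat_r; [lra|].
apply Rinv_le_contravar; [lra|].
assert (H1 := pow_R1_Rle s j ltac:(lra)); simpl; nra.
Qed.

Lemma wallis_ratio_0 (n : nat) : wallis_ratio 0 n = 1.
Proof.
unfold wallis_ratio; assert (Hn := pos_INR n).
assert (H := wallis_sum_pos 0 (INR n + 1 / 2) ltac:(lra)); field; lra.
Qed.

(** The shift of order j + 1 divided by the shift of order 0, which cancels the normalization. *)
Lemma wallis_ratio_rec (j n : nat) :
  wallis_ratio (S j) n - / (INR n + 1 / 2) * wallis_ratio j n =
  wallis_ratio (S j) (S n) - / (INR n + 1) * wallis_ratio j (S n).
Proof.
assert (Hn := pos_INR n).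
assert (H := wallis_sum_shift_S j (INR n + 1 / 2) ltac:(lra)).
assert (H0 := wallis_sum_shift_0 (INR n + 1 / 2) ltac:(lra)).
unfold wallis_ratio; rewrite S_INR.
replace (INR n + 1 + 1 / 2) with (INR n + 1 / 2 + 1) by ring.
assert (Hp := wallis_sum_pos 0 (INR n + 1 / 2) ltac:(lra)).
assert (Hp' := wallis_sum_pos 0 (INR n + 1 / 2 + 1) ltac:(lra)).
set (A := wallis_sum 0 (INR n + 1 / 2)) in *.
set (B := wallis_sum 0 (INR n + 1 / 2 + 1)) in *.
transitivity (((INR n + 1 / 2) * wallis_sum (S j) (INR n + 1 / 2)
   - wallis_sum j (INR n + 1 / 2)) / ((INR n + 1 / 2) * A)); [field; lra|].
rewrite H, H0; field; lra.
Qed.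

(* Complete homogeneous symmetric functions in terms of power sums. *)
Lemma wallis_ratio_telescope (n : nat) :
  let x := power_diff 1 n in
  let y := power_diff 2 n in
  let z := power_diff 3 n in
  wallis_ratio 1 0 = wallis_ratio 1 n + x /\
  wallis_ratio 2 0 = wallis_ratio 2 n + x * wallis_ratio 1 n + (x ^ 2 + y) / 2 /\
  wallis_ratio 3 0 = wallis_ratio 3 n + x * wallis_ratio 2 n
    + (x ^ 2 + y) / 2 * wallis_ratio 1 n + (x ^ 3 + 3 * x * y + 2 * z) / 6.
Proof.
induction n as [|n IH]; cbv zeta.
- unfold power_diff; simpl partial_sum; repeat split; field.
- cbv zeta in IH; destruct IH as [I1 [I2 I3]].
  assert (Hn := pos_INR n).
  assert (R1 := wallis_ratio_rec 0 n); assert (R2 := wallis_ratio_rec 1 n).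
  assert (R3 := wallis_ratio_rec 2 n).
  rewrite !wallis_ratio_0 in R1.
  rewrite I1, I2, I3, !power_diff_succ.
  set (x := power_diff 1 n); set (y := power_diff 2 n); set (z := power_diff 3 n).
  rewrite <- !pow_inv.
  set (a := / (INR n + 1 / 2)) in *; set (b := / (INR n + 1)) in *.
  assert (Q1 : wallis_ratio 1 n = wallis_ratio 1 (S n) + a - b) by lra.
  assert (Q2 : wallis_ratio 2 n = wallis_ratio 2 (S n) + a * wallis_ratio 1 n
    - b * wallis_ratio 1 (S n)) by lra.
  assert (Q3 : wallis_ratio 3 n = wallis_ratio 3 (S n) + a * wallis_ratio 2 n
    - b * wallis_ratio 2 (S n)) by lra.
  rewrite Q3, Q2, Q1; repeat split; field.
Qed.

(** The limit of (x^3 + 3xy + 2z)/6 as x, y, z tend to 2 ln 2, PI^2/3 and 6 zeta(3), times B(1/2,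
    1/2) = PI. *)
Lemma wallis_sum_3_half :
  wallis_sum 3 (1 / 2) =
  PI * (4 / 3 * ln 2 ^ 3 + PI ^ 2 / 3 * ln 2 + 2 * zeta 3).
Proof.
assert (Hx := is_lim_seq_power_diff_1).
assert (Hy := is_lim_seq_power_diff 2 _ is_series_zeta2).
assert (Hz := is_lim_seq_power_diff 3 _ is_series_zeta3).
assert (H1 := is_lim_seq_wallis_ratio 0); assert (H2 := is_lim_seq_wallis_ratio 1).
assert (H3 := is_lim_seq_wallis_ratio 2).
assert (Hx2 := is_lim_seq_mult' _ _ _ _ Hx Hx).
assert (Hx3 := is_lim_seq_mult' _ _ _ _ Hx2 Hx).
assert (Hxy := is_lim_seq_mult' _ _ _ _ Hx Hy).
assert (L := is_lim_seq_plus' _ _ _ _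
  (is_lim_seq_plus' _ _ _ _ H3 (is_lim_seq_mult' _ _ _ _ Hx H2))
  (is_lim_seq_plus' _ _ _ _
    (is_lim_seq_mult' _ _ _ _
      (is_lim_seq_Rscal (/ 2) _ _ (is_lim_seq_plus' _ _ _ _ Hx2 Hy)) H1)
    (is_lim_seq_Rscal (/ 6) _ _ (is_lim_seq_plus' _ _ _ _ Hx3
      (is_lim_seq_plus' _ _ _ _ (is_lim_seq_Rscal 3 _ _ Hxy) (is_lim_seq_Rscal 2 _ _ Hz)))))).
apply (is_lim_seq_ext _ (fun _ => wallis_ratio 3 0)) in L.
2: { intro n; destruct (wallis_ratio_telescope n) as [_ [_ E]].
     cbv zeta in E; rewrite E; field. }
assert (E := is_lim_seq_unique_real _ _ _ (is_lim_seq_const (wallis_ratio 3 0)) L).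
unfold wallis_ratio in E; simpl INR in E; rewrite Rplus_0_l, wallis_sum_half in E.
assert (HP := PI_RGT_0).
apply (Rmult_eq_reg_r (/ PI)); [|apply Rinv_neq_0_compat; lra].
fold (Rdiv (wallis_sum 3 (1 / 2)) PI); rewrite E; field; lra.
Qed.

(** * Leibniz series and the half-integer kernel *)

Definition leib (n : nat) : R := partial_sum (fun k => (-1) ^ k * odd_inv k) n.

Lemma leib_succ (n : nat) : leib (S n) = leib n + (-1) ^ n * odd_inv n.
Proof. reflexivity. Qed.

Lemma is_lim_seq_leib : is_lim_seq leib (PI / 4).
Proof.
rewrite <- Alt_PI_eq; unfold Alt_PI.
destruct exist_PI as [l Hl]; simpl.
replace (4 * l / 4) with l by field.
apply is_lim_seq_Reals in Hl.
apply is_lim_seq_incr_1.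
revert Hl; apply is_lim_seq_ext; intro n.
rewrite <- sum_n_Reals, sum_n_partial_sum.
apply partial_sum_ext; intros k _; unfold tg_alt, PI_tg, odd_inv.
rewrite plus_INR, mult_INR; reflexivity.
Qed.

Lemma odd_inv_decr (k : nat) : odd_inv (S k) <= odd_inv k.
Proof.
assert (Hk := pos_INR k); unfold odd_inv; rewrite S_INR.
apply Rinv_le_contravar; lra.
Qed.

(** Alternating signs and decreasing terms. This uniform bound is what dominates the double sums
    below. *)
Lemma leib_bounds (n : nat) : 0 <= leib n <= 1.
Proof.
assert (H : forall m, 0 <= leib (2 * m) /\ leib (2 * m) + odd_inv (2 * m) <= 1).
{ induction m as [|m [I1 I2]].
  - assert (E : odd_inv 0 = 1) by (unfold odd_inv; simpl; field).
    unfold leib; simpl; lra.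
  - replace (2 * S m)%nat with (S (S (2 * m))) by lia.
    rewrite !leib_succ, <- tech_pow_Rmult, pow_1_even.
    assert (H1 := odd_inv_decr (2 * m)).
    assert (H2 := odd_inv_decr (S (2 * m))).
    split; lra. }
destruct (Nat.Even_or_Odd n) as [[m ->]|[m ->]].
- specialize (H m); assert (Hu := odd_inv_pos (2 * m)); lra.
- replace (2 * m + 1)%nat with (S (2 * m)) by lia.
  rewrite leib_succ, pow_1_even.
  specialize (H m); assert (Hu := odd_inv_pos (2 * m)); lra.
Qed.

Lemma pow_m1_sqr (n : nat) : (-1) ^ n * (-1) ^ n = 1.
Proof. rewrite <- Rpow_mult_distr; replace (-1 * -1) with 1 by ring; apply pow1. Qed.

(** * The alternating kernel and its telescoping sums *)

Lemma odd_minus_even_neq0 (i n : nat) : 2 * INR i + 1 - 2 * INR n <> 0.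
Proof.
intro H.
assert (E : INR (2 * i + 1) = INR (2 * n)).
{ rewrite plus_INR, !mult_INR; change (INR 2) with 2; change (INR 1) with 1; lra. }
apply INR_eq in E; lia.
Qed.

Definition kernel_minus (i n : nat) : R :=
  (-1) ^ i * (-1) ^ n / (2 * INR i + 1 - 2 * INR n).

Definition kernel_plus (i n : nat) : R :=
  (-1) ^ i * (-1) ^ n / (2 * INR i + 1 + 2 * INR n).

Lemma kernel_minus_ge (n d : nat) :
  kernel_minus (n + d) n = leib (S d) - leib d.
Proof.
assert (Hd := pos_INR d); assert (E := pow_m1_sqr n).
unfold kernel_minus; rewrite leib_succ, plus_INR, pow_add.
replace ((-1) ^ n * (-1) ^ d * (-1) ^ n) with ((-1) ^ n * (-1) ^ n * (-1) ^ d) by ring.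
rewrite E; unfold odd_inv; field; lra.
Qed.

(** The Leibniz term (-1)^m/(2m+1) is invariant under m -> -1-m, so the kernel at the negative index
    m = i - n is again an increment of [leib], now at d = n - i - 1. *)
Lemma kernel_minus_lt (i d : nat) :
  kernel_minus i (i + S d) = leib (S d) - leib d.
Proof.
assert (Hd := pos_INR d); assert (E := pow_m1_sqr i).
unfold kernel_minus; rewrite leib_succ, plus_INR, S_INR, pow_add, <- tech_pow_Rmult.
replace ((-1) ^ i * ((-1) ^ i * (-1 * (-1) ^ d))) with (- ((-1) ^ i * (-1) ^ i * (-1) ^ d))
  by ring.
rewrite E; unfold odd_inv; field; split; lra.
Qed.

Lemma kernel_plus_leib (i n : nat) :
  kernel_plus i n = leib (S (i + n)) - leib (i + n).
Proof.
assert (Hi := pos_INR i); assert (Hn := pos_INR n).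
unfold kernel_plus; rewrite leib_succ, pow_add; unfold odd_inv.
rewrite plus_INR; field; lra.
Qed.

(* In the next two lemmas one of the two truncated differences is 0. *)
Lemma partial_sum_kernel_minus_r (i N : nat) :
  partial_sum (fun m => kernel_minus i (S m)) N =
  leib i + leib (N - i) - leib (i - N).
Proof.
induction N as [|N IH]; simpl partial_sum.
- rewrite Nat.sub_0_r, Nat.sub_0_l; unfold leib; simpl; ring.
- rewrite IH.
  destruct (le_lt_dec i N) as [H|H].
  + replace (S N) with (i + S (N - i))%nat at 1 by lia.
    rewrite kernel_minus_lt.
    replace (S N - i)%nat with (S (N - i)) by lia.
    replace (i - N)%nat with 0%nat by lia; replace (i - S N)%nat with 0%nat by lia; ring.
  + replace (kernel_minus i (S N)) with (kernel_minus (S N + (i - S N)) (S N))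
      by (f_equal; lia).
    rewrite kernel_minus_ge.
    replace (i - N)%nat with (S (i - S N)) by lia.
    replace (S N - i)%nat with 0%nat by lia; replace (N - i)%nat with 0%nat by lia; ring.
Qed.

Lemma partial_sum_kernel_minus_l (n M : nat) :
  partial_sum (fun i => kernel_minus i n) M =
  leib n + leib (M - n) - leib (n - M).
Proof.
induction M as [|M IH]; simpl partial_sum.
- rewrite Nat.sub_0_r, Nat.sub_0_l; unfold leib; simpl; ring.
- rewrite IH.
  destruct (le_lt_dec n M) as [H|H].
  + replace (kernel_minus M n) with (kernel_minus (n + (M - n)) n)
      by (f_equal; lia).
    rewrite kernel_minus_ge.
    replace (S M - n)%nat with (S (M - n)) by lia.
    replace (n - M)%nat with 0%nat by lia; replace (n - S M)%nat with 0%nat by lia; ring.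
  + replace (kernel_minus M n) with (kernel_minus M (M + S (n - S M)))
      by (f_equal; lia).
    rewrite kernel_minus_lt.
    replace (n - M)%nat with (S (n - S M)) by lia.
    replace (S M - n)%nat with 0%nat by lia; replace (M - n)%nat with 0%nat by lia; ring.
Qed.

Lemma partial_sum_kernel_plus_r (i N : nat) :
  partial_sum (fun m => kernel_plus i (S m)) N = leib (i + S N) - leib (S i).
Proof.
induction N as [|N IH]; simpl partial_sum.
- replace (i + 1)%nat with (S i) by lia; ring.
- rewrite IH, kernel_plus_leib.
  replace (S (i + S N)) with (i + S (S N))%nat by lia; ring.
Qed.

Lemma partial_sum_kernel_plus_l (n M : nat) :
  partial_sum (fun i => kernel_plus i n) M = leib (M + n) - leib n.
Proof.
induction M as [|M IH]; simpl partial_sum.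
- simpl; ring.
- rewrite IH, kernel_plus_leib; simpl; ring.
Qed.

Lemma is_lim_seq_leib_minus (n : nat) : is_lim_seq (fun M => leib (M - n)) (PI / 4).
Proof.
apply (is_lim_seq_incr_n (fun M => leib (M - n)) n).
apply (is_lim_seq_ext leib); [intro M; f_equal; lia|exact is_lim_seq_leib].
Qed.

Lemma is_lim_seq_leib_sub_l (n : nat) : is_lim_seq (fun M => leib (n - M)) 0.
Proof.
apply (is_lim_seq_incr_n (fun M => leib (n - M)) n).
apply (is_lim_seq_ext (fun _ => 0)); [|apply is_lim_seq_const].
intro M; replace (n - (M + n))%nat with 0%nat by lia; reflexivity.
Qed.

Lemma is_lim_seq_leib_plus (n : nat) : is_lim_seq (fun M => leib (M + n)) (PI / 4).
Proof. apply -> (is_lim_seq_incr_n leib n); exact is_lim_seq_leib. Qed.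

(* With w = i + 1/2 this is the partial fraction expansion of 1/cos at the
   integer n; its value does not depend on n. *)
Lemma is_series_kernel (n : nat) :
  is_series (fun i => kernel_minus i n + kernel_plus i n) (PI / 2).
Proof.
apply is_series_partial_sum.
apply (is_lim_seq_ext (fun M => leib n + leib (M - n) - leib (n - M)
  + (leib (M + n) - leib n))).
- intro M.
  rewrite partial_sum_plus, partial_sum_kernel_minus_l, partial_sum_kernel_plus_l.
  reflexivity.
- apply (is_lim_seq_eq _ (leib n + PI / 4 - 0 + (PI / 4 - leib n))); [|field].
  apply is_lim_seq_plus'; apply is_lim_seq_minus'.
  + apply is_lim_seq_plus'; [apply is_lim_seq_const|apply is_lim_seq_leib_minus].
  + apply is_lim_seq_leib_sub_l.
  + apply is_lim_seq_leib_plus.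
  + apply is_lim_seq_const.
Qed.

Lemma is_series_leib : is_series (fun k => (-1) ^ k * odd_inv k) (PI / 4).
Proof. apply is_series_partial_sum, is_lim_seq_leib. Qed.

Lemma ex_series_alt_odd_inv (p : nat) :
  ex_series (fun k => (-1) ^ k * odd_inv k ^ (S (S p))).
Proof.
apply (ex_series_Rle _ (fun k => odd_inv k ^ 2)).
- intro k; rewrite Rabs_mult, pow_1_abs, Rmult_1_l.
  assert (H := odd_inv_pos k); assert (H1 := odd_inv_le1 k).
  rewrite Rabs_pos_eq by (apply pow_le; lra).
  replace (S (S p)) with (2 + p)%nat by lia; rewrite pow_add.
  assert (H2 : odd_inv k ^ p <= 1 ^ p) by (apply pow_incr; lra).
  rewrite pow1 in H2.
  assert (H3 := pow2_ge_0 (odd_inv k)); nra.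
- eexists; exact is_series_odd_inv_sqr.
Qed.

(** The sum of u_i^2 times the kernel is computed in both orders. Over all integers n the kernel
    sums to PI/2 for every i, and the term n = 0 contributes the unknown [b3]. Over i, with a = 2i+1
    and n = m + 1, the identity 2/(a(a^2 - 4n^2)) = (2a/(a^2 - 4n^2) - 2/a)/(4n^2) reduces each n to
    the kernel and Leibniz series, leaving only odd n. *)
Lemma is_series_beta3 :
  is_series (fun k => (-1) ^ k * odd_inv k ^ 3) (PI ^ 3 / 32).
Proof.
assert (E3 := ex_series_alt_odd_inv 1).
set (b3 := Series (fun k => (-1) ^ k * odd_inv k ^ 3)).
assert (Hb3 : is_series (fun k => (-1) ^ k * odd_inv k ^ 3) b3) by exact (Series_correct _ E3).
set (F := fun N i => odd_inv i ^ 2 * (leib (N - i) - leib (i - N) + leib (i + S N))).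
set (g := fun m => PI / 2 * (1 - (-1) ^ S m) / (2 * (INR m + 1)) ^ 2).
assert (Hm : forall m, is_series
  (fun i => odd_inv i ^ 2 * (kernel_minus i (S m) + kernel_plus i (S m))) (g m)).
{ intro m; assert (Hmp := pos_INR m).
  assert (H := is_series_Rscal (/ (2 * (INR m + 1)) ^ 2) _ _
    (is_series_Rplus _ _ _ _ (is_series_kernel (S m))
      (is_series_Rscal (-2 * (-1) ^ S m) _ _ is_series_leib))).
  apply (is_series_eq _ _ (g m)) in H; [|unfold g; field; lra].
  revert H; apply is_series_Rext; intro i; assert (Hi := pos_INR i).
  assert (Hne := odd_minus_even_neq0 i (S m)).
  unfold kernel_minus, kernel_plus, odd_inv; rewrite S_INR in *.
  field; repeat split; lra. }
assert (HF : forall N, is_series (F N) (b3 + partial_sum g N)).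
{ intro N.
  assert (H := is_series_Rplus _ _ _ _ Hb3 (is_series_partial_sum_swap _ _ Hm N)).
  revert H; apply is_series_Rext; intro i.
  rewrite partial_sum_scal with (f := fun m => kernel_minus i (S m) + kernel_plus i (S m)).
  rewrite partial_sum_plus, partial_sum_kernel_minus_r, partial_sum_kernel_plus_r.
  rewrite leib_succ; unfold F; ring. }
destruct (tannery F (fun i => odd_inv i ^ 2 * (PI / 2)) (fun i => 3 * odd_inv i ^ 2))
  as [_ Hlim].
- intros N i; unfold F; rewrite Rabs_mult, Rmult_comm.
  assert (Hp := pow2_ge_0 (odd_inv i)).
  rewrite (Rabs_pos_eq (odd_inv i ^ 2)) by exact Hp.
  apply Rmult_le_compat_r; [exact Hp|].
  assert (H1 := leib_bounds (N - i)); assert (H2 := leib_bounds (i - N)).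
  assert (H3 := leib_bounds (i + S N)); apply Rabs_le; lra.
- apply ex_series_Rscal; eexists; exact is_series_odd_inv_sqr.
- intro i; apply is_lim_seq_Rscal.
  apply (is_lim_seq_eq _ (PI / 4 - 0 + PI / 4)); [|field].
  apply is_lim_seq_plus'.
  + apply is_lim_seq_minus'; [apply is_lim_seq_leib_minus|apply is_lim_seq_leib_sub_l].
  + apply (is_lim_seq_ext (fun N => leib (N + S i))); [intro N; f_equal; lia|].
    apply is_lim_seq_leib_plus.
- rewrite Series_scal_r, (is_series_unique _ _ is_series_odd_inv_sqr) in Hlim.
  assert (Hg : is_series g (PI ^ 2 / 8 * (PI / 2) - b3)).
  { apply is_series_partial_sum.
    apply (is_lim_seq_ext (fun N => Series (F N) - b3)).
    - intro N; rewrite (is_series_unique _ _ (HF N)); ring.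
    - apply is_lim_seq_minus'; [exact Hlim|apply is_lim_seq_const]. }
  apply is_series_even_odd in Hg.
  assert (H := is_series_Rscal (PI / 4) _ _ is_series_odd_inv_sqr).
  apply (is_series_eq _ b3); [exact Hb3|].
  enough (PI / 4 * (PI ^ 2 / 8) = PI ^ 2 / 8 * (PI / 2) - b3) by lra.
  apply (is_series_unique_real _ _ _ H).
  revert Hg; apply is_series_Rext; intro k; assert (Hk := pos_INR k).
  unfold g, odd_inv.
  replace (S (2 * k + 1)) with (2 * S k)%nat by lia.
  rewrite pow_1_odd, pow_1_even, plus_INR, mult_INR.
  change (INR 2) with 2; change (INR 1) with 1; field; lra.
Qed.

(** Again a double sum, now with u_i^3 and the difference of the kernels, so that the limits PI/4
    cancel and [leib i + leib (S i)] remains. The partial fractions of 4n/(a^3 (a^2 - 4n^2)) contain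
    -1/(n a^3), which brings in beta(3), and with it ln 2 after summing the signs over n. *)
Lemma is_series_cube_leib :
  is_series (fun i => odd_inv i ^ 3 * (leib i + leib (S i)))
    (PI ^ 3 / 32 * ln 2 + 7 / 64 * PI * zeta 3).
Proof.
set (b3 := PI ^ 3 / 32).
set (F := fun N i => odd_inv i ^ 3 *
  (leib i + leib (N - i) - leib (i - N) - leib (i + S N) + leib (S i))).
set (g := fun m => (-1) ^ S m * (- b3 / (INR m + 1) - PI / 16 / (INR m + 1) ^ 3)
  + PI / 16 / (INR m + 1) ^ 3).
assert (Hm : forall m, is_series
  (fun i => odd_inv i ^ 3 * (kernel_minus i (S m) + -1 * kernel_plus i (S m))) (g m)).
{ intro m; assert (Hmp := pos_INR m).
  assert (H := is_series_Rplus _ _ _ _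
    (is_series_Rscal (/ (2 * (INR m + 1)) ^ 3) _ _ (is_series_kernel (S m)))
    (is_series_Rplus _ _ _ _
      (is_series_Rscal (- (-1) ^ S m / (INR m + 1)) _ _ is_series_beta3)
      (is_series_Rscal (-2 * (-1) ^ S m / (2 * (INR m + 1)) ^ 3) _ _ is_series_leib))).
  apply (is_series_eq _ _ (g m)) in H; [|unfold g, b3; field; lra].
  revert H; apply is_series_Rext; intro i; assert (Hi := pos_INR i).
  assert (Hne := odd_minus_even_neq0 i (S m)).
  unfold kernel_minus, kernel_plus, odd_inv; rewrite S_INR in *.
  field; repeat split; lra. }
assert (HF : forall N, is_series (F N) (partial_sum g N)).
{ intro N.
  assert (H := is_series_partial_sum_swap _ _ Hm N).
  revert H; apply is_series_Rext; intro i.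
  rewrite partial_sum_scal with (f := fun m => kernel_minus i (S m) + -1 * kernel_plus i (S m)).
  rewrite partial_sum_plus, partial_sum_scal, partial_sum_kernel_minus_r,
    partial_sum_kernel_plus_r.
  unfold F; ring. }
destruct (tannery F (fun i => odd_inv i ^ 3 * (leib i + leib (S i)))
  (fun i => 5 * odd_inv i ^ 3)) as [Hex Hlim].
- intros N i; unfold F; rewrite Rabs_mult, Rmult_comm.
  assert (Hp := pow_le _ 3 (Rlt_le _ _ (odd_inv_pos i))).
  rewrite (Rabs_pos_eq (odd_inv i ^ 3)) by exact Hp.
  apply Rmult_le_compat_r; [exact Hp|].
  assert (H1 := leib_bounds (N - i)); assert (H2 := leib_bounds (i - N)).
  assert (H3 := leib_bounds (i + S N)); assert (H4 := leib_bounds i).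
  assert (H5 := leib_bounds (S i)); apply Rabs_le; lra.
- apply ex_series_Rscal; eexists; exact is_series_odd_inv_cube.
- intro i; apply is_lim_seq_Rscal.
  apply (is_lim_seq_eq _ (leib i + PI / 4 - 0 - PI / 4 + leib (S i))); [|ring].
  apply is_lim_seq_plus'; [|apply is_lim_seq_const].
  apply is_lim_seq_minus'.
  + apply is_lim_seq_minus'; [|apply is_lim_seq_leib_sub_l].
    apply is_lim_seq_plus'; [apply is_lim_seq_const|apply is_lim_seq_leib_minus].
  + apply (is_lim_seq_ext (fun N => leib (N + S i))); [intro N; f_equal; lia|].
    apply is_lim_seq_leib_plus.
- apply Series_correct in Hex; apply (is_series_eq _ _ _ Hex).
  assert (Hg : is_series g (Series (fun i => odd_inv i ^ 3 * (leib i + leib (S i))))).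
  { apply is_series_partial_sum.
    revert Hlim; apply is_lim_seq_ext.
    intro N; exact (is_series_unique _ _ (HF N)). }
  apply is_series_even_odd in Hg.
  apply (is_series_unique_real _ _ _ Hg).
  assert (H := is_series_Rplus _ _ _ _ (is_series_Rscal b3 _ _ is_series_ln2)
    (is_series_Rscal (PI / 8) _ _ is_series_odd_inv_cube)).
  apply (is_series_eq _ (b3 * ln 2 + PI / 8 * (7 / 8 * zeta 3))); [|field].
  revert H; apply is_series_Rext; intro k; assert (Hk := pos_INR k).
  unfold g, odd_inv.
  replace (S (2 * k + 1)) with (2 * S k)%nat by lia.
  rewrite pow_1_odd, pow_1_even, plus_INR, mult_INR.
  change (INR 2) with 2; change (INR 1) with 1; field; lra.
Qed.

(** Summation by parts: the partial sums of this series and of the preceding one add up to 2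
    [leib n] times [harm3 n]. *)
Lemma is_series_alt_harm3 :
  is_series (fun k => (-1) ^ k * odd_inv k * (harm3 k + harm3 (S k)))
    (21 / 64 * PI * zeta 3 - PI ^ 3 / 32 * ln 2).
Proof.
assert (H := proj1 (is_series_partial_sum _ _) is_series_cube_leib).
assert (H3 := proj1 (is_series_partial_sum _ _) is_series_odd_inv_cube).
apply is_series_partial_sum.
assert (L := is_lim_seq_minus' _ _ _ _
  (is_lim_seq_Rscal 2 _ _ (is_lim_seq_mult' _ _ _ _ is_lim_seq_leib H3)) H).
apply (is_lim_seq_eq _ _ (21 / 64 * PI * zeta 3 - PI ^ 3 / 32 * ln 2)) in L; [|field].
revert L; apply is_lim_seq_ext; intro n; fold (harm3 n).
induction n as [|n IH]; simpl partial_sum.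
- unfold leib, harm3; simpl; ring.
- rewrite <- IH, leib_succ; unfold harm3; simpl partial_sum; ring.
Qed.

(** * The hypergeometric series *)

Lemma wallis_binomial (n : nat) : 1 / 4 ^ n * Binomial.C (2 * n) n = wallis n.
Proof.
induction n as [|n IH].
- unfold Binomial.C; simpl; field.
- assert (Hn := pos_INR n).
  simpl wallis; rewrite <- IH; unfold Binomial.C.
  replace (2 * S n - S n)%nat with (S n) by lia.
  replace (2 * n - n)%nat with n by lia.
  replace (2 * S n)%nat with (S (S (2 * n))) by lia.
  rewrite !fact_simpl, !mult_INR, !S_INR, mult_INR.
  change (INR 2) with 2; simpl pow.
  assert (Hf := INR_fact_neq_0 n); assert (H4 : 4 ^ n <> 0) by (apply pow_nonzero; lra).
  field; repeat split; lra || assumption.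
Qed.

Lemma pochhammer_1 (n : nat) : pochhammer 1 n = INR (fact n).
Proof.
induction n as [|n IH]; [reflexivity|].
rewrite fact_simpl, mult_INR, S_INR; simpl; rewrite IH; ring.
Qed.

Lemma pochhammer_half (n : nat) : pochhammer (1 / 2) n = wallis n * INR (fact n).
Proof.
induction n as [|n IH]; [simpl; ring|].
assert (Hn := pos_INR n).
rewrite fact_simpl, mult_INR, S_INR; simpl; rewrite IH; field; lra.
Qed.

Lemma pochhammer_three_halves (n : nat) :
  pochhammer (3 / 2) n = pochhammer (1 / 2) n * (2 * INR n + 1).
Proof.
induction n as [|n IH]; [simpl; ring|].
rewrite S_INR; simpl; rewrite IH; field.
Qed.

Lemma hypergeometric_term_wallis (n : nat) :
  hypergeometric_term [1/2; 1/2; 1/2; 1/2; 1/2] [1; 3/2; 3/2; 3/2] 1 n =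
  wallis n ^ 2 * odd_inv n ^ 3.
Proof.
assert (Hn := pos_INR n); assert (Hw := wallis_pos n).
assert (Hf := INR_fact_neq_0 n).
unfold hypergeometric_term, pochhammers; simpl map; simpl fold_right.
rewrite pochhammer_1, pochhammer_three_halves, pochhammer_half, pow1.
unfold odd_inv; field; repeat split; lra || assumption.
Qed.

(** Pairing at eps^3. Although [moment_coef 3] is written in h = [harm k] and u = [odd_inv k],
    multiplying it by -3 makes it symmetric in [harm k] and [harm (S k)]; the factor 2 from the
    moments accounts for the scaling -3/2. *)
Lemma is_series_wallis_cube :
  is_series (fun k => (-1) ^ k * odd_inv k *
      (32 * (harm (S k) ^ 3 + harm k ^ 3) + 16 * (harm3 (S k) + harm3 k)))
    (3 / 2 * PI * (4 / 3 * ln 2 ^ 3 + PI ^ 2 / 3 * ln 2 + 2 * zeta 3)).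
Proof.
destruct (legendre_pairing 3 wallis (fun k => 2 * odd_inv k)) as [_ H].
- lia.
- intro n; rewrite Rabs_pos_eq by (apply Rlt_le, wallis_pos); lra.
- exact is_series_wallis_moment.
- change (Series _) with (wallis_sum 3 (1 / 2)) in H.
  rewrite wallis_sum_3_half in H.
  apply (is_series_Rscal (-3 / 2)) in H.
  apply (is_series_eq _ _ (3 / 2 * PI *
    (4 / 3 * ln 2 ^ 3 + PI ^ 2 / 3 * ln 2 + 2 * zeta 3))) in H; [|simpl pow; field].
  revert H; apply is_series_Rext; intro k; assert (Hk := pos_INR k).
  unfold moment_coef, harm, harm3; simpl partial_sum; unfold odd_inv; field; lra.
Qed.

(** Pairing at eps^2. The extra u^2 from the moments leaves u^2 (6h^2 + 6hu + 3u^2), which is u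
    times 2((h+u)^3 - h^3) + u^3. *)
Lemma wallis_sqr_series :
  ex_series (fun n => wallis n ^ 2 * odd_inv n ^ 3) /\
  is_series (fun k => (-1) ^ k * odd_inv k * (2 * (harm (S k) ^ 3 - harm k ^ 3)
      + odd_inv k ^ 3))
    (3 / 4 * PI * Series (fun n => wallis n ^ 2 * odd_inv n ^ 3)).
Proof.
assert (HP := PI_RGT_0).
assert (E : forall n, / 8 * (wallis n ^ 2 / (INR n + 1 / 2) ^ 3) =
  wallis n ^ 2 * odd_inv n ^ 3).
{ intro n; assert (Hn := pos_INR n); unfold odd_inv; field; lra. }
destruct (legendre_pairing 2 (fun n => wallis n ^ 2) (fun k => 4 * / PI * odd_inv k ^ 2))
  as [Hex H].
- lia.
- intro n; assert (H := wallis_pos n); assert (H1 := wallis_le1 n).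
  rewrite Rabs_pos_eq by nra; nra.
- intro k; apply is_series_wallis_sqr_moment, is_lim_seq_wallis_sqr.
- split.
  + apply (ex_series_Rscal (/ 8)) in Hex; revert Hex; apply ex_series_Rext, E.
  + apply (is_series_Rscal (3 * PI / 32)) in H.
    apply (is_series_eq _ _ (3 / 4 * PI * Series (fun n => wallis n ^ 2 * odd_inv n ^ 3)))
      in H; [|rewrite <- (Series_ext _ _ E), Series_scal_l; simpl pow; field].
    revert H; apply is_series_Rext; intro k; assert (Hk := pos_INR k).
    unfold moment_coef, harm, harm3; simpl partial_sum; unfold odd_inv; field; lra.
Qed.

(* [Binomial.C] is the binomial coefficient; plain [C] is Coquelicot's type of
   complex numbers. *)
Theorem mainTheorem6 :
  let lhs := fun n : nat =>
    1 / (2 * INR n + 1) ^ 3 * (1 / 4 ^ n * Binomial.C (2 * n) n) ^ 2 in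
  let upper := [1/2; 1/2; 1/2; 1/2; 1/2] in
  let lower := [1; 3/2; 3/2; 3/2] in
  let alt := fun n : nat =>
    (-1) ^ n * odd_harmonic n ^ 3 / (2 * INR n + 1) in
  ex_series lhs /\
  ex_series (hypergeometric_term upper lower 1) /\
  ex_series alt /\
  Series lhs = hypergeometric upper lower 1 /\
  hypergeometric upper lower 1 =
    16 / (3 * PI) * Series alt - (ln 2) ^ 3 / 6 - PI ^ 2 / 12 * ln 2
    + 3 / 16 * zeta 3 + 4 / (3 * PI) * dirichlet_beta 4.
Proof.
intros lhs upper lower alt.
assert (HP := PI_RGT_0).
destruct wallis_sqr_series as [Hex Hs].
set (S0 := Series (fun n => wallis n ^ 2 * odd_inv n ^ 3)) in *.
assert (El : forall n, wallis n ^ 2 * odd_inv n ^ 3 = lhs n).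
{ intro n; unfold lhs; rewrite wallis_binomial; unfold odd_inv.
  assert (Hn := pos_INR n); field; lra. }
assert (Eh : forall n, wallis n ^ 2 * odd_inv n ^ 3 = hypergeometric_term upper lower 1 n).
{ intro n; symmetry; apply hypergeometric_term_wallis. }
assert (Sh : hypergeometric upper lower 1 = S0).
{ unfold hypergeometric; symmetry; apply Series_ext, Eh. }
assert (Hb : is_series (fun k => (-1) ^ k * odd_inv k ^ 4) (dirichlet_beta 4)).
{ replace (dirichlet_beta 4) with (Series (fun k => (-1) ^ k * odd_inv k ^ 4)).
  - exact (Series_correct _ (ex_series_alt_odd_inv 2)).
  - apply Series_ext; intro k; unfold odd_inv; rewrite pow_inv; reflexivity. }
(* The weight 1/64 gives half the sum of cubes plus a quarter of the [harm3] terms, and the second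
   series removes the latter. The third gives half the difference of cubes plus u_k^4/4 with its
   sign, and beta(4)/4 removes the surplus. Convergence of [alt] comes with its value. *)
assert (Ha : is_series alt (/ 64 * (3 / 2 * PI *
    (4 / 3 * ln 2 ^ 3 + PI ^ 2 / 3 * ln 2 + 2 * zeta 3))
  + (- / 4 * (21 / 64 * PI * zeta 3 - PI ^ 3 / 32 * ln 2)
  + (/ 4 * (3 / 4 * PI * S0) + - / 4 * dirichlet_beta 4)))).
{ assert (H := is_series_Rplus _ _ _ _ (is_series_Rscal (/ 64) _ _ is_series_wallis_cube)
    (is_series_Rplus _ _ _ _ (is_series_Rscal (- / 4) _ _ is_series_alt_harm3)
    (is_series_Rplus _ _ _ _ (is_series_Rscal (/ 4) _ _ Hs)
      (is_series_Rscal (- / 4) _ _ Hb)))).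
  revert H; apply is_series_Rext; intro k.
  unfold alt; rewrite odd_harmonic_harm; unfold odd_inv.
  assert (Hk := pos_INR k); field; lra. }
repeat split.
- revert Hex; apply ex_series_Rext, El.
- revert Hex; apply ex_series_Rext, Eh.
- eexists; exact Ha.
- rewrite Sh; symmetry; apply Series_ext, El.
- rewrite Sh, (is_series_unique _ _ Ha); field; lra.
Qed.
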